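(* Let $n\ge 1$, let $E=\mathbb{C}[[t]]^n\subset \mathbb{C}((t))^n$, and let $L,M,N$ be lattices in $\mathbb{C}((t))^n$ with $E\subseteq L\subseteq t^{-1}E$, $E\subseteq M\subseteq t^{-1}E$ and $E\subseteq N\subseteq t^{-1}E$. Let $i,j,k$ be nonnegative integers with $i+j+k=n$. Then $$f^t_{i,j,k}(L,M,N)=\min_{P}\bigl(f^t_{i,j+k}(L,P)+f^t_{j,i+k}(M,P)+f^t_{k,i+j}(N,P)-2f^t_n(P)\bigr),$$ where $P$ ranges over all lattices in $\mathbb{C}((t))^n$ (equivalently, $$f^t_{i,j,k}(L,M,N)=\min_{P}\bigl(f^t_{i,j,k}(L,P,P)+f^t_{i,j,k}(P,M,P)+f^t_{i,j,k}(P,P,N)-2f^t_{i,j,k}(P,P,P)\bigr)).$$ In particular, the minimum is attained by at least one of the following choices of $P$: $$tE,\quad L,\quad M,\quad N,\quad L+M,\quad L+N,\quad M+N,\quad L+M+N.$$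
   Context: A lattice in $\mathbb{C}((t))^n$ is a $\mathbb{C}[[t]]$-submodule of $\mathbb{C}((t))^n$ generated by $n$ vectors that are linearly independent over $\mathbb{C}((t))$. For $x=\sum_m a_m t^m\in\mathbb{C}((t))$ nonzero, $\operatorname{val}(x)$ is the smallest $m$ with $a_m\neq 0$, and $\operatorname{val}(0)=+\infty$. For nonnegative integers $i_1,\dots,i_r$ with $i_1+\cdots+i_r=n$ and lattices $L_1,\dots,L_r$ in $\mathbb{C}((t))^n$, the determinantal valuation is $$f^t_{i_1,\dots,i_r}(L_1,\dots,L_r)=\max\bigl(-\operatorname{val}\det(v_{11},\dots,v_{1i_1},v_{21},\dots,v_{2i_2},\dots,v_{r1},\dots,v_{ri_r})\bigr),$$ where the maximum is over all choices of vectors $v_{ab}\in L_a$ ($1\le a\le r$, $1\le b\le i_a$). In particular $f^t_n(P)$ (the case $r=1$) is the maximum of $-\operatorname{val}\det(v_1,\dots,v_n)$ over $v_1,\dots,v_n\in P$. *)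

(* Defs.v *)
From HB Require Import structures.
From mathcomp Require Import all_boot all_order all_algebra.
From mathcomp Require Import zify.
From mathcomp Require Import complex.
From mathcomp Require Import boolp classical_sets cardinality fsbigop.
From mathcomp Require Import reals constructive_ereal.

Set Implicit Arguments.
Unset Strict Implicit.
Unset Printing Implicit Defensive.

Import Order.TTheory GRing.Theory Num.Theory.
Local Open Scope classical_set_scope.
Local Open Scope ring_scope.

(** [laurent K] is K((t)), given by coefficient functions with support bounded
    below. *)
Record laurent (K : fieldType) := Laurent {
  lcoef :> int -> K ;
  _ : exists N : int, forall m, m < N -> lcoef m = 0 }.

HB.instance Definition _ (K : fieldType) := gen_eqMixin (laurent K).
HB.instance Definition _ (K : fieldType) := gen_choiceMixin (laurent K).

Lemma laurentP (K : fieldType) (f g : laurent K) : lcoef f =1 lcoef g -> f = g.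
Proof.
case: f g => [f pf] [g pg] /= /funext fg; subst g.
by congr Laurent; apply: Prop_irrelevance.
Qed.

Definition lbnd (K : fieldType) (N : nat) (f : int -> K) :=
  forall m, m < - N%:Z -> f m = 0.

Lemma lbndP (K : fieldType) (f : laurent K) : exists N, lbnd N f.
Proof.
case: f => f [N HN] /=; exists `|N|%N => m mN; apply: HN; lia.
Qed.

Lemma lbnd_ex (K : fieldType) (N : nat) (f : int -> K) :
  lbnd N f -> exists N : int, forall m, m < N -> f m = 0.
Proof. by move=> h; exists (- N%:Z). Qed.

Lemma lbndW (K : fieldType) (N M : nat) (f : int -> K) :
  (N <= M)%N -> lbnd N f -> lbnd M f.
Proof. by move=> NM h m mM; apply: h; lia. Qed.

Lemma lmonom_proof (K : fieldType) (d : int) :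
  exists N : int, forall m, m < N -> (m == d)%:R = 0 :> K.
Proof. by exists d => m md; rewrite lt_eqF. Qed.

Definition lmonom (K : fieldType) (d : int) : laurent K :=
  Laurent (@lmonom_proof K d).

Lemma lzero_proof (K : fieldType) :
  exists N : int, forall m : int, m < N -> 0 = 0 :> K.
Proof. by exists 0. Qed.
Definition lzero (K : fieldType) : laurent K := Laurent (lzero_proof K).

Lemma lopp_proof (K : fieldType) (f : laurent K) :
  exists N : int, forall m, m < N -> - f m = 0.
Proof.
by have [N h] := lbndP f; apply: (@lbnd_ex _ N) => m mN; rewrite h ?oppr0.
Qed.
Definition lopp (K : fieldType) (f : laurent K) : laurent K :=
  Laurent (lopp_proof f).

Lemma ladd_proof (K : fieldType) (f g : laurent K) :
  exists N : int, forall m, m < N -> f m + g m = 0.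
Proof.
have [N hf] := lbndP f; have [M hg] := lbndP g.
apply: (@lbnd_ex _ (N + M)) => m mN; rewrite hf ?hg ?addr0 //; lia.
Qed.
Definition ladd (K : fieldType) (f g : laurent K) : laurent K :=
  Laurent (ladd_proof f g).

Lemma laddA (K : fieldType) : associative (@ladd K).
Proof. by move=> f g h; apply: laurentP => m /=; rewrite addrA. Qed.
Lemma laddC (K : fieldType) : commutative (@ladd K).
Proof. by move=> f g; apply: laurentP => m /=; rewrite addrC. Qed.
Lemma ladd0 (K : fieldType) : left_id (lzero K) (@ladd K).
Proof. by move=> f; apply: laurentP => m /=; rewrite add0r. Qed.
Lemma laddN (K : fieldType) : left_inverse (lzero K) (@lopp K) (@ladd K).
Proof. by move=> f; apply: laurentP => m /=; rewrite addNr. Qed.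

HB.instance Definition _ (K : fieldType) :=
  GRing.isZmodule.Build (laurent K) (@laddA K) (@laddC K) (@ladd0 K) (@laddN K).

(** Cauchy product; for series bounded below the sum has finite support. *)
Definition lconv (K : fieldType) (f g : int -> K) (m : int) : K :=
  \sum_(i \in [set: int]) f i * g (m - i).

Lemma lconvE (K : fieldType) (f g : int -> K) N M (k : nat) :
  lbnd N f -> lbnd M g ->
  lconv f g (k%:Z - (N + M)%N%:Z) =
  \sum_(i < k.+1) f (i%:Z - N%:Z) * g ((k - i)%N%:Z - M%:Z).
Proof.
move=> hf hg; rewrite /lconv.
pose r : seq int := [seq i%:Z - N%:Z | i <- iota 0 k.+1].
have ur : uniq r by rewrite map_inj_uniq ?iota_uniq // => a b ab; lia.
rewrite -(@fsbig_widen _ _ _ _ [set` r]) //; last first.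
  move=> /= a [_ /= nar]; have [aN|aN] := ltP a (- N%:Z).
    by rewrite hf ?mul0r.
  rewrite [X in _ * X]hg ?mulr0 //.
  case: (ltP (k%:Z - N%:Z) a) => [|ak]; first by lia.
  case: nar; apply/mapP; exists (absz (a + N%:Z)); last by lia.
  by rewrite mem_iota; lia.
rewrite -fsbig_seq // big_map -[iota 0 k.+1]/(index_iota 0 k.+1) big_mkord.
by apply: eq_bigr => -[i ik] _ /=; congr (_ * g _); lia.
Qed.

Lemma lbnd_lconv (K : fieldType) (f g : int -> K) N M :
  lbnd N f -> lbnd M g -> lbnd (N + M) (lconv f g).
Proof.
move=> hf hg m mNM; rewrite /lconv fsbig1 // => i _.
have [iN|iN] := ltP i (- N%:Z); first by rewrite hf ?mul0r.
by rewrite [X in _ * X]hg ?mulr0 //; lia.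
Qed.

Lemma lmul_proof (K : fieldType) (f g : laurent K) :
  exists N : int, forall m, m < N -> lconv f g m = 0.
Proof.
have [N hf] := lbndP f; have [M hg] := lbndP g.
exact: lbnd_ex (lbnd_lconv hf hg).
Qed.
Definition lmul (K : fieldType) (f g : laurent K) : laurent K :=
  Laurent (lmul_proof f g).

(** [lrep N D f p]: [f] agrees with [t ^ (- N) p] below degree [D - N]; the
    ring axioms are transferred from {poly K}. *)
Definition lrep (K : fieldType) N D (f : laurent K) (p : {poly K}) :=
  lbnd N f /\ forall k, (k < D)%N -> f (k%:Z - N%:Z) = p`_k.

Lemma lrep_ex (K : fieldType) N D (f : laurent K) :
  lbnd N f -> exists p, lrep N D f p.
Proof.
move=> hf; exists (\poly_(k < D) f (k%:Z - N%:Z)); split => // k kD.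
by rewrite coef_poly kD.
Qed.

Lemma lrep_eq (K : fieldType) N (f g : laurent K) :
  (forall D, exists2 p, lrep N D f p & lrep N D g p) -> f = g.
Proof.
move=> h; apply: laurentP => m; have [mN|mN] := ltP m (- N%:Z).
  by have [p [hf _] [hg _]] := h 0%N; rewrite hf // hg.
have [p [_ hf] [_ hg]] := h (absz (m + N%:Z)).+1.
have -> : m = (absz (m + N%:Z))%:Z - N%:Z by lia.
by rewrite hf // hg.
Qed.

Lemma lrepD (K : fieldType) N D (f g : laurent K) p q :
  lrep N D f p -> lrep N D g q -> lrep N D (f + g) (p + q).
Proof.
move=> [bf hf] [bg hg]; split => [m mN|k kD].
  by rewrite /= bf // bg // addr0.
by rewrite /= hf // hg // coefD.
Qed.

Lemma lrepM (K : fieldType) N M D (f g : laurent K) p q :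
  lrep N D f p -> lrep M D g q -> lrep (N + M) D (lmul f g) (p * q).
Proof.
move=> [bf hf] [bg hg]; split => [|k kD]; first exact: lbnd_lconv.
rewrite /= lconvE // coefM; apply: eq_bigr => -[i ik] _ /=.
by rewrite hf ?hg //; lia.
Qed.

Lemma lrep1 (K : fieldType) D : lrep 0 D (lmonom K 0) 1.
Proof.
split => [m mN|k kD] /=; first by rewrite lt_eqF //; lia.
by rewrite coef1 subr0.
Qed.

Lemma lmulA (K : fieldType) : associative (@lmul K).
Proof.
move=> f g h; have [N hf] := lbndP f; have [M hg] := lbndP g.
have [Q hh] := lbndP h; apply: (@lrep_eq _ (N + (M + Q))) => D.
have [p fp] := lrep_ex D hf; have [q gq] := lrep_ex D hg.
have [r hr] := lrep_ex D hh; exists (p * (q * r)); first by do !apply: lrepM.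
by rewrite mulrA addnA; do !apply: lrepM.
Qed.

Lemma lmulC (K : fieldType) : commutative (@lmul K).
Proof.
move=> f g; have [N hf] := lbndP f; have [M hg] := lbndP g.
apply: (@lrep_eq _ (N + M)) => D.
have [p fp] := lrep_ex D hf; have [q gq] := lrep_ex D hg.
by exists (p * q); [|rewrite mulrC addnC]; apply: lrepM.
Qed.

Lemma lmul1 (K : fieldType) : left_id (lmonom K 0) (@lmul K).
Proof.
move=> f; have [N hf] := lbndP f; apply: (@lrep_eq _ N) => D.
have [p fp] := lrep_ex D hf; exists p => //.
by rewrite -[N]add0n -[p]mul1r; apply: lrepM => //; apply: lrep1.
Qed.

Lemma lmulDl (K : fieldType) : left_distributive (@lmul K) +%R.
Proof.
move=> f g h; have [N1 hf] := lbndP f; have [N2 hg] := lbndP g.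
have [M hh] := lbndP h.
have {}hf := lbndW (leq_addr N2 N1) hf; have {}hg := lbndW (leq_addl N1 N2) hg.
apply: (@lrep_eq _ (N1 + N2 + M)) => D.
have [p fp] := lrep_ex D hf; have [q gq] := lrep_ex D hg.
have [r hr] := lrep_ex D hh; exists ((p + q) * r).
  by apply: lrepM => //; apply: lrepD.
by rewrite mulrDl; apply: lrepD; apply: lrepM.
Qed.

Lemma lone_neq0 (K : fieldType) : lmonom K 0 != 0.
Proof.
apply/eqP => /(congr1 (fun f : laurent K => f 0)) /=.
by move=> /eqP; rewrite oner_eq0.
Qed.

HB.instance Definition _ (K : fieldType) :=
  GRing.Zmodule_isComNzRing.Build (laurent K)
    (@lmulA K) (@lmulC K) (@lmul1 K) (@lmulDl K) (@lone_neq0 K).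

Lemma lcoefD (K : fieldType) (f g : laurent K) m : (f + g) m = f m + g m.
Proof. by []. Qed.

Lemma lcoefM (K : fieldType) (f g : laurent K) m :
  (f * g) m = \sum_(i \in [set: int]) f i * g (m - i).
Proof. by []. Qed.

Lemma lcoef1 (K : fieldType) m : (1 : laurent K) m = (m == 0)%:R.
Proof. by []. Qed.

Definition lead_index (K : fieldType) (f : laurent K) (m : int) :=
  f m != 0 /\ forall k, k < m -> f k = 0.

Lemma lead_index_ex (K : fieldType) (f : laurent K) :
  f != 0 -> exists m, lead_index f m.
Proof.
move=> f0; have [N hf] := lbndP f.
have ex : exists k : nat, f (k%:Z - N%:Z) != 0.
  apply: contrapT => nex; move/eqP: f0; apply; apply: laurentP => m /=.
  have [/hf//|mN] := ltP m (- N%:Z).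
  apply/eqP/negPn/negP => fm; apply: nex; exists (absz (m + N%:Z)).
  by have -> : (absz (m + N%:Z))%:Z - N%:Z = m by lia.
have [k fk kmin] := ex_minnP ex; exists (k%:Z - N%:Z); split => // j jk.
have [/hf//|jN] := ltP j (- N%:Z).
apply/eqP/negPn/negP => fj.
have := kmin (absz (j + N%:Z)); have -> : (absz (j + N%:Z))%:Z - N%:Z = j by lia.
by move=> /(_ fj); lia.
Qed.

Fixpoint linv_seq (K : fieldType) (u : nat -> K) (n : nat) : seq K :=
  if n is n'.+1 then
    rcons (linv_seq u n')
      (((n' == 0)%N%:R - \sum_(j < n') u (n' - j)%N * (linv_seq u n')`_j) / u 0%N)
  else [::].

Lemma size_linv_seq (K : fieldType) (u : nat -> K) n : size (linv_seq u n) = n.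
Proof. by elim: n => //= n IH; rewrite size_rcons IH. Qed.

Lemma nth_linv_seq (K : fieldType) (u : nat -> K) n k :
  (k < n)%N -> (linv_seq u n)`_k = (linv_seq u k.+1)`_k.
Proof.
elim: n => // n IH; rewrite ltnS leq_eqVlt => /predU1P[-> //|kn].
by rewrite [LHS]/= nth_rcons size_linv_seq kn IH.
Qed.

Lemma linv_seqP (K : fieldType) (u : nat -> K) k : u 0%N != 0 ->
  \sum_(j < k.+1) u (k - j)%N * (linv_seq u j.+1)`_j = (k == 0)%N%:R.
Proof.
move=> u0; rewrite big_ord_recr /= subnn nth_rcons size_linv_seq ltnn eqxx.
rewrite mulrC divfK //; set s := BIG_F.
rewrite [X in X + _](eq_bigr (fun j : 'I_k => u (k - j)%N * (linv_seq u k)`_j)).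
  by rewrite addrC subrK.
by move=> j _; rewrite (nth_linv_seq _ (ltn_ord j)).
Qed.

Lemma lunit_ex (K : fieldType) (f : laurent K) : f != 0 -> exists g, g * f = 1.
Proof.
move=> /lead_index_ex[v [fv vmin]].
pose u (k : nat) := f (v + k%:Z).
have u0 : u 0%N != 0 by rewrite /u addr0.
pose g (m : int) := if 0 <= m then (linv_seq u `|m|.+1)`_`|m|%N else 0.
pose gs (m : int) := g (m + v).
have bg : exists N : int, forall m, m < N -> gs m = 0.
  by exists (- v) => m mv; rewrite /gs /g ifF //; lia.
exists (Laurent bg); apply: laurentP => m; rewrite lcoefM lcoef1 /=.
have -> : \sum_(i \in [set: int]) gs i * f (m - i) =
          \sum_(i \in [set: int]) g i * f (m + v - i).
  rewrite (reindex_fsbigT (fun i : int => i - v)); last first.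
    by exists (fun i : int => i + v) => i; rewrite ?subrK ?addrK.
  by apply: eq_fsbigr => i _; rewrite /gs subrK; congr (_ * f _); lia.
have [m0|m0] := ltP m 0.
  rewrite fsbig1 => [|i _]; first by rewrite lt_eqF.
  rewrite /g; case: ifPn => i0; last by rewrite mul0r.
  by rewrite vmin ?mulr0 //; lia.
pose f' (k : int) := f (v + k).
have bg' : lbnd 0 g by move=> k k0; rewrite /g ifF //; lia.
have bf' : lbnd 0 f' by move=> k k0; rewrite /f' vmin //; lia.
have := lconvE `|m|%N bg' bf'.
have -> : `|m|%N%:Z - (0 + 0)%N%:Z = m by lia.
rewrite /lconv => h.
transitivity (\sum_(i \in [set: int]) g i * f' (m - i)).
  by apply: eq_fsbigr => i _; rewrite /f'; congr (_ * f _); lia.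
rewrite h -absz_eq0 -(linv_seqP `|m|%N u0); apply: eq_bigr => i _.
by rewrite mulrC !subr0.
Qed.

Definition linv (K : fieldType) (f : laurent K) : laurent K :=
  xget 0 [set g | g * f = 1].

Lemma lmulVf (K : fieldType) (f : laurent K) : f != 0 -> linv f * f = 1.
Proof.
by move=> /lunit_ex[g gf]; rewrite /linv; case: xgetP => // /(_ g).
Qed.

Lemma linv0 (K : fieldType) : linv (0 : laurent K) = 0.
Proof.
rewrite /linv; case: xgetP => // g _ /eqP.
by rewrite mulr0 eq_sym oner_eq0.
Qed.

HB.instance Definition _ (K : fieldType) :=
  GRing.ComNzRing_isField.Build (laurent K) (@lmulVf K) (@linv0 K).

Definition tvar (K : fieldType) : laurent K := lmonom K 1.

(** [lead_index f] holds of at most one [m] (see [lval_lead]), and of none when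
    [f = 0]. *)
Definition lval (K : fieldType) (f : laurent K) : \bar int :=
  xget +oo%E [set m%:E | m in lead_index f].

Lemma lval0 (K : fieldType) : lval (0 : laurent K) = +oo%E.
Proof. by rewrite /lval; case: xgetP => // x _ [m [/eqP]]. Qed.

Lemma lval_lead (K : fieldType) (f : laurent K) m :
  lead_index f m -> lval f = m%:E.
Proof.
move=> [fm mmin]; rewrite /lval; case: xgetP => [x -> [k [fk kmin] <-]|/(_ m%:E)[]].
  congr EFin; case: (ltgtP k m) => // h.
    by rewrite mmin ?eqxx in fk.
  by rewrite kmin ?eqxx in fm.
by exists m.
Qed.

Definition power_series (K : fieldType) : set (laurent K) :=
  [set f | forall m : int, m < 0 -> f m = 0].

Definition is_lattice (K : fieldType) (n : nat) (L : set 'cV[laurent K]_n) :=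
  exists v : n.-tuple 'cV[laurent K]_n, free v /\
    L = [set \sum_(i < n) a i *: tnth v i
        | a in [set a : 'I_n -> laurent K | forall i, power_series (a i)]].

Definition stdE (K : fieldType) (n : nat) : set 'cV[laurent K]_n :=
  [set v | forall i, power_series (v i 0)].
Arguments stdE K n : clear implicits.

Definition scale_set (K : fieldType) (n : nat) (x : laurent K)
    (L : set 'cV[laurent K]_n) : set 'cV[laurent K]_n :=
  [set x *: v | v in L].

Definition sum_set (K : fieldType) (n : nat) (L M : set 'cV[laurent K]_n) :
    set 'cV[laurent K]_n :=
  [set u + v | u in L & v in M].

(** For [s = [:: (i_1, L_1); ...; (i_r, L_r)]] with i_1 + ... + i_r = n, the
    matrices whose first i_1 columns lie in L_1, next i_2 columns in L_2, etc. *)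
Definition block_columns (K : fieldType) (n : nat)
    (s : seq (nat * set 'cV[laurent K]_n)) : set 'M[laurent K]_n :=
  [set A | forall c : 'I_n,
     nth set0 (flatten [seq nseq p.1 p.2 | p <- s]) c (col c A)].

Definition is_max (d : Order.disp_t) (T : porderType d) (S : set T) (m : T) :=
  S m /\ ubound S m.

Definition is_min (d : Order.disp_t) (T : porderType d) (S : set T) (m : T) :=
  S m /\ lbound S m.

(** The maximum is a finite integer as soon as the [L_a] are lattices and the
    multiplicities add up to [n]; otherwise the value may be the dummy 0. *)
Definition detval (K : fieldType) (n : nat)
    (s : seq (nat * set 'cV[laurent K]_n)) : int :=
  xget 0 [set m : int |
    is_max [set (- lval (\det A))%E | A in block_columns s] m%:E].

(* Main.v *)
Require Import Defs.
From HB Require Import structures.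
From mathcomp Require Import all_boot all_order all_algebra.
From mathcomp Require Import perm zify.

(** Upper bound on the left-hand side: if the columns of X lie in L, reduction
    over the discrete valuation ring K[[t]] gives X = Q T with the columns of Q
    in P and the valuation of det T at least f_n(P) - f_{i,n-i}(L,P); applying
    this to the three blocks of a matrix with columns in L, M, N gives
    f(L,M,N) <= g(P) for every lattice P.

    Equality for one of the eight lattices: L, M, N are the preimages of
    subspaces A, B, C of t^-1 E / E = K^n, and f(L,M,N) is at least the largest
    number of independent vectors with at most i of them in A, j in B, k in C.
    By Rado's theorem that number is the minimum over subfamilies S of
    {A,B,C} of the dimension of the sum over S plus the multiplicities outside
    S.  If P is the sum of the lattices in S (or tE when S is empty), g(P) is at
    most the value of that expression at S. *)

Set Implicit Arguments.
Unset Strict Implicit.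
Unset Printing Implicit Defensive.

Import Order.TTheory GRing.Theory Num.Theory.
Local Open Scope ring_scope.

(** * Ranks of sums of subspaces and Rado's theorem *)

(** From the modular law for dimensions: the span over the union lies in the sum of the two spans,
    the span over the intersection in their intersection. *)
Lemma mxrank_sums_submod (F : fieldType) (T : finType) (n : nat)
    (U : T -> 'M[F]_n) (D : 'M[F]_n) (S S' : {set T}) :
  (\rank (D + \sum_(c in S :|: S') U c) + \rank (D + \sum_(c in S :&: S') U c)
   <= \rank (D + \sum_(c in S) U c) + \rank (D + \sum_(c in S') U c))%N.
Proof.
rewrite -[leqRHS]mxrank_sum_cap leq_add // mxrankS //.
  rewrite addsmx_sub (submx_trans (addsmxSl _ _) (addsmxSl _ _)) /=.
  apply/sumsmx_subP => c; rewrite in_setU => /orP[cS|cS].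
    apply: submx_trans (addsmxSl _ _).
    by apply: submx_trans (addsmxSr _ _); rewrite (sumsmx_sup c).
  apply: submx_trans (addsmxSr _ _).
  by apply: submx_trans (addsmxSr _ _); rewrite (sumsmx_sup c).
rewrite sub_capmx !addsmx_sub !addsmxSl /=; apply/andP; split.
  apply/sumsmx_subP => c; rewrite in_setI => /andP[cS _].
  by apply: submx_trans (addsmxSr _ _); rewrite (sumsmx_sup c).
apply/sumsmx_subP => c; rewrite in_setI => /andP[_ cS].
by apply: submx_trans (addsmxSr _ _); rewrite (sumsmx_sup c).
Qed.

Lemma mxrank_adds_row (F : fieldType) (m n : nat) (D : 'M[F]_(m, n))
    (v : 'rV[F]_n) :
  ~~ (v <= D)%MS -> \rank (D + v)%MS = (\rank D).+1.
Proof.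
move=> vD; apply/eqP; rewrite eqn_leq; apply/andP; split.
  apply: leq_trans (mxrank_adds_leqif D v) _.
  by rewrite -[X in (_ <= X)%N]addn1 leq_add2l rank_leq_row.
have : (D < D + v)%MS.
  by rewrite ltmxE addsmxSl /= addsmx_sub submx_refl.
exact: rank_ltmx.
Qed.

(* Rado's theorem on independent transversals, in its defect form and relative
   to a subspace [D].  The vector for an index [e] is taken outside the span
   attached to the largest set violating the condition after removing [e];
   submodularity of the rank makes that largest set unique. *)
Lemma independent_transversal (F : fieldType) (T : finType) (n : nat)
    (U : T -> 'M[F]_n) (I : {set T}) (D : 'M[F]_n) (h : nat) :
  (forall S : {set T}, S \subset I ->
     h + \rank D <= \rank (D + \sum_(c in S) U c)%MS + #|I :\: S|)%N ->
  exists J : {set T}, exists x : T -> 'rV[F]_n,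
    [/\ J \subset I, forall c, c \in J -> (x c <= U c)%MS,
        \rank (D + \sum_(c in J) <<x c>>)%MS = (\rank D + #|J|)%N
      & (h <= #|J|)%N].
Proof.
have [m] := ubnP #|I|; elim: m => // m IH in I D h *.
rewrite ltnS => Im cond.
pose rk (S : {set T}) := \rank (D + \sum_(c in S) U c)%MS.
have submod S S' : (rk (S :|: S') + rk (S :&: S') <= rk S + rk S')%N.
  exact: mxrank_sums_submod.
have {}cond (S : {set T}) : S \subset I ->
    (h + \rank D <= rk S + #|I :\: S|)%N := cond S.
have [I0|[e eI]] := set_0Vmem I.
  exists set0, (fun=> 0); split.
  - exact: sub0set.
  - by move=> c; rewrite in_set0.
  - by rewrite big_set0 addsmx0 cards0 addn0.
  - have := cond set0 (sub0set _); rewrite /rk I0 set0D cards0 big_set0 addn0.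
    by rewrite addsmx0; lia.
pose I' := I :\ e.
have cI : #|I| = #|I'|.+1 by rewrite (cardsD1 e I) eI.
have I'm : (#|I'| < m)%N by rewrite -cI.
have I'I : I' \subset I by exact: subD1set.
(* The sets violating the hypothesis for [I'] with the same [D] and [h]. If there is none, induction
   gives a transversal that avoids [e]. *)
pose bad (S : {set T}) := (S \subset I') &&
  (rk S + #|I' :\: S| < h + \rank D)%N.
have cardD (S : {set T}) : S \subset I' -> #|I :\: S| = #|I' :\: S|.+1.
  move=> SI'; rewrite (cardsD1 e) in_setD eI andbT.
  have -> : e \notin S.
    by apply/negP => /(subsetP SI'); rewrite in_setD1 eqxx.
  by rewrite add1n; congr _.+1; apply: eq_card => c; rewrite !inE andbCA andbA.
have [/existsP [S0 badS0]|nbad] := boolP [exists S, bad S]; last first.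
  have [S SI'|J [x [JI' xU rkJ hJ]]] := IH I' D h I'm.
    rewrite leqNgt; apply/negP => lt; move/negP: nbad; apply.
    by apply/existsP; exists S; rewrite /bad SI'.
  by exists J, x; split=> //; apply: subset_trans JI' I'I.
have [Q [QI' Qlt Qmax]] : exists Q : {set T}, [/\ Q \subset I',
    (rk Q + #|I' :\: Q| < h + \rank D)%N
    & forall S : {set T}, bad S -> (#|S| <= #|Q|)%N].
  have [Q /andP[QI' Qlt] Qmax] := arg_maxnP (fun S : {set T} => #|S|) badS0.
  by exists Q.
(* Passing from [I] to [I'] lowers the right-hand side of [cond] by one, so a bad set misses the
   bound by exactly one. *)
have badE (S : {set T}) : bad S ->
    (rk S + #|I' :\: S|).+1 = (h + \rank D)%N.
  move=> /andP[SI' Slt]; have := cond S (subset_trans SI' I'I).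
  by rewrite cardD //; lia.
(* By submodularity [S :|: Q] is bad, because [S :&: Q] falls short by at most one; maximality of
   [Q] then gives [S :|: Q = Q]. *)
have Qtop (S : {set T}) : bad S -> S \subset Q.
  move=> bS; have [SI' Slt] := andP bS; have SE := badE _ bS.
  have QE : (rk Q + #|I' :\: Q|).+1 = (h + \rank D)%N.
    by apply: badE; rewrite /bad QI'.
  have bad' : bad (S :|: Q).
    rewrite /bad subUset SI' QI' /=.
    have := submod S Q.
    have capI : S :&: Q \subset I.
      by apply: subset_trans I'I; apply: subset_trans SI'; exact: subsetIl.
    have := cond _ capI; rewrite cardD; last first.
      by apply: subset_trans SI'; exact: subsetIl.
    have := cardsUI (I' :\: S) (I' :\: Q).
    by rewrite -setDUr -setDIr; lia.
  have := Qmax _ bad' => leSQ.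
  have : Q :==: S :|: Q by rewrite eqEcard subsetUr.
  by move=> /eqP ->; exact: subsetUl.
(* Otherwise [e |: Q] would have no larger rank than [Q] and would violate [cond]. *)
have nUe : ~~ (U e <= D + \sum_(c in Q) U c)%MS.
  apply/negP => Ue; have eQ : e \notin Q.
    by apply/negP => /(subsetP QI'); rewrite in_setD1 eqxx.
  have QeI : e |: Q \subset I.
    by rewrite subUset sub1set eI; apply: subset_trans I'I.
  have : (rk (e |: Q) <= rk Q)%N.
    rewrite /rk big_setU1 //=; apply: mxrankS.
    by rewrite !addsmx_sub addsmxSl addsmxSr Ue.
  have := cond _ QeI.
  have -> : I :\: (e |: Q) = I' :\: Q by rewrite /I' setDDl.
  by lia.
have /row_subPn[r nv] := nUe; set v := row r (U e) in nv.
have h_gt0 : (0 < h)%N.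
  have : (\rank D <= rk Q)%N by exact/mxrankS/addsmxSl.
  by lia.
have vD : ~~ (v <= D)%MS.
  by apply: contra nv => /submx_trans; apply; apply: addsmxSl.
have rkDv : \rank (D + v)%MS = (\rank D).+1 by exact: mxrank_adds_row.
have [S SI'|J [x [JI' xU rkJ hJ]]] := IH I' (D + v)%MS h.-1 I'm.
  rewrite rkDv.
  have -> : \rank ((D + v) + \sum_(c in S) U c)%MS =
            \rank ((D + \sum_(c in S) U c) + v)%MS.
    by rewrite -!addsmxA [(v + _)%MS]addsmxC.
  have := cond S (subset_trans SI' I'I); rewrite cardD //.
  (* If [v] is outside the span over [S], it raises the rank by one, which pays for the loss of [e].
     If it is inside, [S] is not contained in [Q], hence not bad. *)
  have [vS|vS] := boolP (v <= D + \sum_(c in S) U c)%MS; last first.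
    have -> : \rank (D + \sum_(c in S) U c + v)%MS = (rk S).+1.
      exact: mxrank_adds_row.
    by lia.
  have : (rk S <= \rank (D + \sum_(c in S) U c + v)%MS)%N.
    exact/mxrankS/addsmxSl.
  have nbS : ~~ bad S.
    apply/negP => /Qtop SQ; move/negP: nv; apply; apply: submx_trans vS _.
    rewrite addsmxS //; apply/sumsmx_subP => c cS.
    by rewrite (sumsmx_sup c) // (subsetP SQ).
  by move: nbS; rewrite /bad SI' /= -leqNgt; lia.
have eJ : e \notin J.
  by apply/negP => /(subsetP JI'); rewrite in_setD1 eqxx.
exists (e |: J), (fun c => if c == e then v else x c); split.
- by rewrite subUset sub1set eI; apply: subset_trans I'I.
- move=> c; rewrite in_setU1; case: (eqVneq c e) => [-> _|_ /= /xU//].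
  exact: row_sub.
- rewrite big_setU1 //= eqxx addsmxA.
  rewrite (eq_bigr (fun c => <<x c>>%MS)); last first.
    by move=> c cJ; case: (eqVneq c e) => // ce; rewrite ce (negPf eJ) in cJ.
  have -> : \rank (D + <<v>> + \sum_(c in J) <<x c>>)%MS =
            \rank (D + v + \sum_(c in J) <<x c>>)%MS.
    by apply/eqP; rewrite eqn_leq !mxrankS // addsmxS // addsmxS // genmxE.
  by rewrite rkJ rkDv cardsU1 eJ; lia.
- by rewrite cardsU1 eJ; lia.
Qed.

(** Rado's theorem is applied twice: first to choose the rows in [J], then relative to their span
    [D], with the whole space as every subspace, to complete them to a basis. *)
Lemma basis_transversal (F : fieldType) (n : nat) (U : 'I_n -> 'M[F]_n)
    (h : nat) :
  (forall S : {set 'I_n}, h <= \rank (\sum_(c in S) U c)%MS + #|~: S|)%N ->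
  exists J : {set 'I_n}, exists Y : 'M[F]_n,
    [/\ Y \in unitmx, forall c, c \in J -> (row c Y <= U c)%MS & (h <= #|J|)%N].
Proof.
move=> cond.
have [S _|J [x [_ xU rkJ hJ]]] :=
    @independent_transversal F _ n U [set: 'I_n] 0 h.
  by rewrite mxrank0 addn0 adds0mx setTD; exact: cond.
rewrite adds0mx mxrank0 add0n in rkJ.
set D := (\sum_(c in J) <<x c>>)%MS in rkJ.
have cJ : (#|J| + #|~: J| = n)%N by rewrite cardsC card_ord.
have [S SJ|J' [x' [J'J _ rkJ' hJ']]] :=
    @independent_transversal F _ n (fun=> 1%:M) (~: J) D #|~: J|.
  have [->|[s sS]] := set_0Vmem S.
    by rewrite big_set0 addsmx0 setD0 addnC.
  rewrite rkJ addnC cJ (leq_trans _ (leq_addr _ _)) //.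
  rewrite -{1}(mxrank1 F n) mxrankS //; apply: submx_trans (addsmxSr _ _).
  by rewrite (sumsmx_sup s).
have J'E : J' = ~: J by apply/eqP; rewrite eqEcard J'J.
exists J, (\matrix_c if c \in J then x c else x' c); split=> //.
  rewrite -row_full_unit /row_full eqn_leq rank_leq_row /=.
  rewrite -{1}cJ -{1}rkJ -J'E -rkJ' mxrankS // addsmx_sub.
  apply/andP; split; apply/sumsmx_subP => c cJ0; rewrite genmxE.
    by apply/submxP; exists (delta_mx 0 c); rewrite -rowE rowK cJ0.
  apply/submxP; exists (delta_mx 0 c); rewrite -rowE rowK.
  by move: cJ0; rewrite J'E in_setC => /negPf ->.
by move=> c cJ0; rewrite rowK cJ0; exact: xU.
Qed.

Lemma sum_three_blocks (i j k : nat) (a b c : nat) :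
  (\sum_(x < i + j + k)
     (if x < i then a else if x < i + j then b else c) = i * a + j * b + k * c)%N.
Proof.
rewrite !big_split_ord /=; congr (_ + _ + _)%N.
- rewrite (eq_bigr (fun=> a)) ?sum_nat_const ?card_ord // => x _.
  by rewrite ltn_ord.
- rewrite (eq_bigr (fun=> b)) ?sum_nat_const ?card_ord // => x _.
  by rewrite ltnNge leq_addr ltn_add2l ltn_ord.
rewrite (eq_bigr (fun=> c)) ?sum_nat_const ?card_ord // => x _.
by rewrite ifF ?ifF //; lia.
Qed.

(* The quantity minimized in Rado's theorem, for the subfamily of those of the
   three subspaces that are selected by [b]. *)
Definition rado_bound (F : fieldType) (n i j k : nat) (A B C : 'M[F]_n)
    (b : bool * bool * bool) : nat :=
  (i * ~~ b.1.1 + j * ~~ b.1.2 + k * ~~ b.2 +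
   \rank ((if b.1.1 then A else 0%R) + (if b.1.2 then B else 0%R)
          + (if b.2 then C else 0%R))%MS)%N.

(** Let [b] select the blocks that [S] meets: their subspaces lie in the span over [S], while the
    other blocks lie wholly in the complement of [S]. Eight bounds thus replace one for every set of
    columns. *)
Lemma rado_bound_le (F : fieldType) (n i j k : nat) (A B C : 'M[F]_n)
    (S : {set 'I_n}) : (i + j + k)%N = n ->
  exists b, (rado_bound i j k A B C b <=
    \rank (\sum_(c in S) (if c < i then A else if c < i + j then B else C)%N)%MS
    + #|~: S|)%N.
Proof.
move=> e; set U := (X in (\sum_(c in S) X c)%MS).
pose bA := [exists c in S, (c < i)%N].
pose bB := [exists c in S, (i <= c)%N && (c < i + j)%N].
pose bC := [exists c in S, (i + j <= c)%N].
exists (bA, bB, bC); rewrite /rado_bound /= addnC leq_add //.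
  have US c : c \in S -> (U c <= \sum_(c in S) U c)%MS.
    by move=> cS; apply: (sumsmx_sup c).
  apply: mxrankS; rewrite !addsmx_sub; apply/andP; split; [apply/andP; split|].
  - case: ifP => [/existsP[c /andP[/US cS ci]]|]; last by rewrite sub0mx.
    by move: cS; rewrite {1}/U ci.
  - case: ifP => [/existsP[c /and3P[/US cS ic cj]]|]; last by rewrite sub0mx.
    by move: cS; rewrite {1}/U ltnNge ic cj.
  - case: ifP => [/existsP[c /andP[/US cS jc]]|]; last by rewrite sub0mx.
    by move: cS; rewrite {1}/U ifF ?ifF //; lia.
rewrite -sum_three_blocks e -sum1_card [leqRHS]big_mkcond /=.
apply: leq_sum => c _; rewrite in_setC; case: (boolP (c \in S)) => [cS|_] /=.
  case: (ltnP c i) => [ci|ic].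
    suff -> : bA by [].
    by apply/existsP; exists c; rewrite cS.
  case: (ltnP c (i + j)) => [cj|jc].
    suff -> : bB by [].
    by apply/existsP; exists c; rewrite cS ic cj.
  suff -> : bC by [].
  by apply/existsP; exists c; rewrite cS jc.
by do 2?case: ifP => _; rewrite leq_b1.
Qed.

From mathcomp Require Import complex.
From mathcomp Require Import boolp classical_sets cardinality fsbigop.
From mathcomp Require Import reals constructive_ereal.

Local Open Scope classical_set_scope.
Local Open Scope ring_scope.

(** * Valuation bounds for Laurent series and determinants *)

(** Valuation at least [m], stated on coefficients so that zero satisfies it for every [m] and no
    infinite value is involved. *)
Definition val_ge (K : fieldType) (f : laurent K) (m : int) :=
  forall k, k < m -> f k = 0.

Lemma val_geW (K : fieldType) (f : laurent K) m m' :
  m' <= m -> val_ge f m -> val_ge f m'.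
Proof. by move=> mm fm k km; apply: fm; apply: lt_le_trans mm. Qed.

Lemma val_ge0 (K : fieldType) m : val_ge (0 : laurent K) m.
Proof. by []. Qed.

Lemma val_geD (K : fieldType) (f g : laurent K) m :
  val_ge f m -> val_ge g m -> val_ge (f + g) m.
Proof. by move=> fm gm k km; rewrite lcoefD fm ?gm ?addr0. Qed.

Lemma val_geN (K : fieldType) (f : laurent K) m : val_ge f m -> val_ge (- f) m.
Proof. by move=> fm k km /=; rewrite fm ?oppr0. Qed.

Lemma val_ge_sum (K : fieldType) (I : Type) (r : seq I) (P : pred I)
    (F : I -> laurent K) m :
  (forall i, P i -> val_ge (F i) m) -> val_ge (\sum_(i <- r | P i) F i) m.
Proof.
move=> Fm; elim/big_ind: _ => //; first by move=> f g; exact: val_geD.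
Qed.

Lemma lcoef_sum (K : fieldType) (I : Type) (r : seq I) (P : pred I)
    (F : I -> laurent K) m :
  (\sum_(i <- r | P i) F i) m = \sum_(i <- r | P i) F i m.
Proof. by elim/big_rec2: _ => // i x y _ <-. Qed.

Lemma val_geM (K : fieldType) (f g : laurent K) a b :
  val_ge f a -> val_ge g b -> val_ge (f * g) (a + b).
Proof.
move=> fa gb k kab; rewrite lcoefM fsbig1 // => i _.
have [ia|ia] := ltP i a; first by rewrite fa ?mul0r.
by rewrite [X in _ * X]gb ?mulr0 //; lia.
Qed.

(** Only the term at [a] survives in the Cauchy product: earlier ones vanish through [f], later ones
    through [g]. *)
Lemma lcoefM_lead (K : fieldType) (f g : laurent K) a b :
  val_ge f a -> val_ge g b -> (f * g) (a + b) = f a * g b.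
Proof.
move=> fa gb; rewrite lcoefM -(@fsbig_widen _ _ _ _ [set a]) //; last first.
  move=> /= i [_ /= /eqP ia]; have [lt|lt] := ltP i a.
    by rewrite fa ?mul0r.
  by rewrite [X in _ * X]gb ?mulr0 //; lia.
by rewrite fsbig_set1; congr (_ * g _); lia.
Qed.

Lemma lcoef_monomM (K : fieldType) (f : laurent K) d m :
  (lmonom K d * f) m = f (m - d).
Proof.
rewrite lcoefM -(@fsbig_widen _ _ _ _ [set d]) //; last first.
  by move=> /= i [_ /= /eqP /negPf ->]; rewrite mul0r.
by rewrite fsbig_set1 /= eqxx mul1r.
Qed.

Lemma lmonomD (K : fieldType) a b : lmonom K (a + b) = lmonom K a * lmonom K b.
Proof.
apply: laurentP => m; rewrite lcoef_monomM /=; congr (_%:R).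
by congr nat_of_bool; apply/eqP/eqP; lia.
Qed.

Lemma lmonom_neq0 (K : fieldType) d : lmonom K d != 0.
Proof.
apply/eqP => /(congr1 (fun f : laurent K => f d)) /=.
by rewrite eqxx => /eqP; rewrite oner_eq0.
Qed.

Lemma tvarV (K : fieldType) : (tvar K)^-1 = lmonom K (-1).
Proof.
have t0 : tvar K != 0 := lmonom_neq0 K 1.
by apply: (mulfI t0); rewrite divff // -lmonomD.
Qed.

Lemma val_ge_monom (K : fieldType) d : val_ge (lmonom K d) d.
Proof. by move=> k kd /=; rewrite lt_eqF. Qed.

Lemma val_ge1 (K : fieldType) : val_ge (1 : laurent K) 0.
Proof. exact: val_ge_monom. Qed.

Lemma val_ge_prod (K : fieldType) (I : Type) (r : seq I) (P : pred I)
    (F : I -> laurent K) (w : I -> int) :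
  (forall i, P i -> val_ge (F i) (w i)) ->
  val_ge (\prod_(i <- r | P i) F i) (\sum_(i <- r | P i) w i).
Proof.
move=> Fw; elim/big_rec2: _ => [|i y f Pi fy]; first exact: val_ge1.
exact: val_geM (Fw i Pi) fy.
Qed.

Lemma lcoef0_prod (K : fieldType) (I : Type) (r : seq I) (P : pred I)
    (F : I -> laurent K) : (forall i, P i -> val_ge (F i) 0) ->
  (\prod_(i <- r | P i) F i) 0 = \prod_(i <- r | P i) F i 0.
Proof.
(* [lcoefM_lead] needs the partial product to be integral, so integrality joins the induction. *)
move=> F0; suff [] : val_ge (\prod_(i <- r | P i) F i) 0 /\
    (\prod_(i <- r | P i) F i) 0 = \prod_(i <- r | P i) F i 0 by [].
elim/big_rec2: _ => [|i y f Pi [f0 <-]].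
  by split; [exact: val_ge1 | rewrite lcoef1 eqxx].
split; first by rewrite -[0]addr0; apply: val_geM => //; exact: F0.
by rewrite -[X in (_ * _ : laurent K) X]addr0 lcoefM_lead //; exact: F0.
Qed.

Lemma val_geMsign (K : fieldType) (f : laurent K) (b : bool) m :
  val_ge f m -> val_ge ((-1) ^+ b * f) m.
Proof.
by case: b => fm; rewrite ?expr1 ?expr0 ?mul1r // mulN1r; exact: val_geN.
Qed.

(** Each term of the Leibniz expansion has exactly one factor from every row. *)
Lemma val_ge_det (K : fieldType) (n : nat) (A : 'M[laurent K]_n)
    (w : 'I_n -> int) :
  (forall r c, val_ge (A r c) (w r)) -> val_ge (\det A) (\sum_r w r).
Proof.
move=> Aw; apply: val_ge_sum => s _; apply: val_geMsign.
by apply: val_ge_prod => r _.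
Qed.

Lemma val_ge_det_col (K : fieldType) (n : nat) (A : 'M[laurent K]_n)
    (w : 'I_n -> int) :
  (forall r c, val_ge (A r c) (w c)) -> val_ge (\det A) (\sum_c w c).
Proof.
by move=> Aw; rewrite -det_tr; apply: val_ge_det => r c; rewrite mxE.
Qed.

(** Reduction modulo t is a ring morphism on integral series, so it commutes with the
    determinant. *)
Lemma lcoef0_det (K : fieldType) (n : nat) (A : 'M[laurent K]_n) :
  (forall r c, val_ge (A r c) 0) ->
  (\det A) 0 = \det (map_mx (fun f : laurent K => f 0) A).
Proof.
move=> A0; rewrite /determinant lcoef_sum; apply: eq_bigr => s _.
have E (b : bool) (f : laurent K) : ((-1) ^+ b * f) 0 = (-1) ^+ b * f 0.
  by case: b; rewrite ?expr1 ?expr0 ?mul1r // !mulN1r.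
rewrite E lcoef0_prod //; congr (_ * _); apply: eq_bigr => i _.
by rewrite mxE.
Qed.

Lemma lead_index_val_ge (K : fieldType) (f : laurent K) a b :
  lead_index f a -> val_ge f b -> b <= a.
Proof.
move=> [fa _] fb; rewrite leNgt; apply/negP => /fb fa0.
by rewrite fa0 eqxx in fa.
Qed.

Lemma lead_indexM (K : fieldType) (f g : laurent K) a b :
  lead_index f a -> lead_index g b -> lead_index (f * g) (a + b).
Proof.
move=> [fa fa'] [gb gb']; split; last exact: val_geM.
by rewrite lcoefM_lead // mulf_neq0.
Qed.

Lemma lead_index1 (K : fieldType) : lead_index (1 : laurent K) 0.
Proof. by split; [rewrite lcoef1 eqxx oner_eq0 | exact: val_ge1]. Qed.

Lemma lead_index_uniq (K : fieldType) (f : laurent K) a b :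
  lead_index f a -> lead_index f b -> a = b.
Proof.
move=> fa fb; apply/eqP; rewrite eq_le.
by rewrite (lead_index_val_ge fb fa.2) (lead_index_val_ge fa fb.2).
Qed.

Lemma val_ge_mulr_cancel (K : fieldType) (f g : laurent K) a b :
  lead_index g b -> val_ge (f * g) (a + b) -> val_ge f a.
Proof.
move=> gb fg; have [->|/lead_index_ex[c fc]] := eqVneq f 0.
  exact: val_ge0.
have := lead_index_val_ge (lead_indexM fc gb) fg.
by rewrite lerD2r => ac; apply: val_geW ac _; exact: fc.2.
Qed.

(** * Integral matrices and elimination over K[[t]] *)

Definition integral_mx (K : fieldType) (m n : nat) (A : 'M[laurent K]_(m, n)) :=
  forall r c, val_ge (A r c) 0.

Lemma val_ge_mulmx (K : fieldType) (m n p : nat) (A : 'M[laurent K]_(m, n))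
    (B : 'M[laurent K]_(n, p)) a r c :
  (forall s, val_ge (A r s) 0) -> (forall s, val_ge (B s c) a) ->
  val_ge ((A *m B) r c) a.
Proof.
move=> A0 Ba; rewrite mxE; apply: val_ge_sum => s _.
by rewrite -[a]add0r; apply: val_geM.
Qed.

Lemma integral_mulmx (K : fieldType) (m n p : nat) (A : 'M[laurent K]_(m, n))
    (B : 'M[laurent K]_(n, p)) :
  integral_mx A -> integral_mx B -> integral_mx (A *m B).
Proof. by move=> A0 B0 r c; apply: val_ge_mulmx. Qed.

Lemma integral_scalar (K : fieldType) (n : nat) :
  integral_mx (1%:M : 'M[laurent K]_n).
Proof. by move=> r c; rewrite mxE; case: eqP => _; [exact: val_ge1|]. Qed.

Lemma integral_det (K : fieldType) (n : nat) (A : 'M[laurent K]_n) :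
  integral_mx A -> val_ge (\det A) 0.
Proof.
move=> A0; have := @val_ge_det _ _ A (fun=> 0) A0.
by rewrite big1.
Qed.

(** Membership of [G] in GL_n(K[[t]]), with the inverse [H] kept as data so that its integrality is
    at hand. *)
Definition invertible_over_O (K : fieldType) (n : nat)
    (G H : 'M[laurent K]_n) :=
  [/\ integral_mx G, integral_mx H & G *m H = 1%:M].

Lemma invertible_over_OM (K : fieldType) (n : nat)
    (G H G' H' : 'M[laurent K]_n) :
  invertible_over_O G H -> invertible_over_O G' H' ->
  invertible_over_O (G *m G') (H' *m H).
Proof.
move=> [Gi Hi GH] [G'i H'i GH']; split; try exact: integral_mulmx.
by rewrite mulmxA -(mulmxA G) GH' mulmx1.
Qed.

(** Both determinants have nonnegative valuation, and the two valuations add up to 0. *)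
Lemma lead_index_det_invertible (K : fieldType) (n : nat)
    (G H : 'M[laurent K]_n) : invertible_over_O G H -> lead_index (\det H) 0.
Proof.
move=> [G0 H0 GH].
have GH1 : \det G * \det H = 1 by rewrite -det_mulmx GH det1.
have /lead_index_ex[g gl] : \det G != 0.
  by apply/eqP => g0; move/eqP: GH1; rewrite g0 mul0r eq_sym oner_eq0.
have /lead_index_ex[h hl] : \det H != 0.
  by apply/eqP => g0; move/eqP: GH1; rewrite g0 mulr0 eq_sym oner_eq0.
have := lead_indexM gl hl; rewrite GH1 => gh.
have := lead_index_uniq gh (lead_index1 K).
have := lead_index_val_ge gl (integral_det G0).
have := lead_index_val_ge hl (integral_det H0) => h0 g0 gh0.
by have -> : 0 = h by lia.
Qed.

(** Of two Laurent series one divides the other with integral quotient, so a finite family has a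
    member dividing all of them. It serves as pivot in the elimination; [x0] starts the induction on
    the empty list. *)
Lemma integral_divisor_ex (K : fieldType) (T : finType) (x0 : T)
    (f : T -> laurent K) :
  exists p : T, exists q : T -> laurent K,
    forall r, val_ge (q r) 0 /\ f r = q r * f p.
Proof.
have tot (x y : laurent K) : (exists q, val_ge q 0 /\ y = q * x) \/
    (exists q, val_ge q 0 /\ x = q * y).
  have [->|x0'] := eqVneq x 0; first by right; exists 0; rewrite mul0r.
  have [->|y0'] := eqVneq y 0; first by left; exists 0; rewrite mul0r.
  have [a xa] := lead_index_ex x0'; have [b yb] := lead_index_ex y0'.
  have [ab|ba] := leP a b; [left|right].
    exists (y / x); split; last by rewrite divfK.
    by apply: (val_ge_mulr_cancel xa); rewrite divfK // add0r; apply: val_geW yb.2.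
  exists (x / y); split; last by rewrite divfK.
  apply: (val_ge_mulr_cancel yb); rewrite divfK // add0r.
  by apply: val_geW xa.2; exact: ltW.
suff [p hp] : exists p, forall r, r \in enum T ->
    exists q, val_ge q 0 /\ f r = q * f p.
  by have [q hq] := choice (fun r => hp r (mem_enum _ r)); exists p, q.
elim: (enum T) => [|a s [p hp]]; first by exists x0.
have [[q [q0 qE]]|[q [q0 qE]]] := tot (f p) (f a).
  by exists p => r; rewrite inE => /predU1P[->|/hp//]; exists q.
exists a => r; rewrite inE => /predU1P[->|/hp[q' [q'0 ->]]].
  by exists 1; split; [exact: val_ge1 | rewrite mul1r].
exists (q' * q); split; last by rewrite qE mulrA.
by rewrite -[0]addr0; apply: val_geM.
Qed.

(* Row echelon form over the discrete valuation ring K[[t]]: the pivot is an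
   entry of least valuation, so that the multipliers are integral. *)
Lemma integral_triangularization (K : fieldType) (m n : nat)
    (A : 'M[laurent K]_(m, n)) :
  exists G H : 'M[laurent K]_m, invertible_over_O G H /\
    forall (r : 'I_m) (c : 'I_n), (c < r)%N -> (G *m A) r c = 0.
Proof.
have triv m' n' (A' : 'M[laurent K]_(m', n')) : m' = 0%N \/ n' = 0%N ->
    exists G H : 'M[laurent K]_m', invertible_over_O G H /\
    forall (r : 'I_m') (c : 'I_n'), (c < r)%N -> (G *m A') r c = 0.
  move=> mn; exists 1%:M, 1%:M; split.
    by split; rewrite ?mulmx1 //; exact: integral_scalar.
  by case: mn => e; move: A'; rewrite e => A' [? ?] // [].
elim: m => [|m IH] in n A *; first by apply: triv; left.
case: n A => [|n] A; first by apply: triv; right.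
have [p [q hq]] := integral_divisor_ex ord0 (fun r => A r ord0).
pose G1 : 'M[laurent K]_(1 + m) := tperm_mx ord0 p.
have G1K : G1 *m G1 = 1%:M.
  by rewrite /G1 /tperm_mx -perm_mxM tperm2 perm_mx1.
have G1i : integral_mx G1.
  by move=> r c; rewrite !mxE; case: eqP => _; [exact: val_ge1|].
have [A1 defA1] : exists A1 : 'M[laurent K]_(1 + m, 1 + n), A1 = G1 *m A.
  by exists (G1 *m A).
have A1E r c : A1 r c = A (tperm ord0 p r) c.
  by rewrite defA1 /G1 /tperm_mx -row_permE mxE.
(* Each first entry below the pivot in [A1] is one of these integral multipliers times the pivot, so
   [G2] clears the column and its inverse [H2] is integral too. *)
pose qc : 'M[laurent K]_(m, 1) := \col_r q (tperm ord0 p (rshift 1 r)).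
have qi : integral_mx qc by move=> r c; rewrite mxE; apply: (hq _).1.
pose G2 : 'M[laurent K]_(1 + m) := block_mx 1 0 (- qc) 1%:M.
pose H2 : 'M[laurent K]_(1 + m) := block_mx 1 0 qc 1%:M.
have intb (X : 'M[laurent K]_(m, 1)) (Y : 'M[laurent K]_m) :
    integral_mx X -> integral_mx Y ->
    integral_mx (block_mx (1 : 'M_1) 0 X Y).
  move=> Xi Yi r c; rewrite -[r]splitK -[c]splitK.
  case: (fintype.split r) => r'; case: (fintype.split c) => c' /=.
  - by rewrite block_mxEul; apply: integral_scalar.
  - by rewrite block_mxEur mxE.
  - by rewrite block_mxEdl.
  - by rewrite block_mxEdr.
have [G3 [H3 [[G3i H3i GH3] tri]]] := IH _ (drsubmx (G2 *m A1)).
pose G4 : 'M[laurent K]_(1 + m) := block_mx 1 0 0 G3.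
pose H4 : 'M[laurent K]_(1 + m) := block_mx 1 0 0 H3.
exists (G4 *m G2 *m G1), (G1 *m (H2 *m H4)).
have i0 : integral_mx (0 : 'M[laurent K]_(m, 1)) by move=> r c; rewrite mxE.
have Ni : integral_mx (- qc) by move=> r c; rewrite mxE; apply: val_geN.
have GH2 : G2 *m H2 = 1%:M.
  rewrite mulmx_block !mul0mx !mulmx0 !mul1mx !mulmx1 !addr0 add0r addNr.
  by rewrite -scalar_mx_block.
have GH4 : G4 *m H4 = 1%:M.
  rewrite mulmx_block !mul0mx !mulmx0 !mul1mx !addr0 add0r GH3.
  by rewrite -scalar_mx_block.
split.
  apply: (@invertible_over_OM _ (1 + m) (G4 *m G2) (H2 *m H4) G1 G1) => //.
  by apply: invertible_over_OM; split=> //; apply: intb => //; exact: integral_scalar.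
move=> r c cr; rewrite -!mulmxA.
rewrite -defA1; set A2 : 'M[laurent K]_(1 + m, 1 + n) := G2 *m A1.
have dl0 : dlsubmx A2 = 0.
  rewrite /A2 -[A1]submxK mulmx_block block_mxKdl mul1mx.
  apply/matrixP => x y; rewrite !ord1 mxE [RHS]mxE mxE big_ord1 !mxE !A1E.
  rewrite !lshift0 !tpermL (hq (tperm ord0 p (rshift 1 x))).2.
  by rewrite mulNr addNr.
have -> : G4 *m A2 = block_mx (ulsubmx A2) (ursubmx A2) 0 (G3 *m drsubmx A2).
  rewrite -{1}[A2]submxK mulmx_block dl0.
  by rewrite !mul0mx !mulmx0 !mul1mx !addr0 !add0r.
case: (@split_ordP 1 m r) cr => r' ->; case: (@split_ordP 1 n c) => c' -> /= cr.
- by rewrite !ord1 in cr.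
- by rewrite ord1 in cr.
- by apply: etrans (block_mxEdl _ _ _ _ _ _) _; rewrite mxE.
- by apply: etrans (block_mxEdr _ _ _ _ _ _) _; rewrite tri //; move: cr; rewrite !add1n.
Qed.

(** A triangular matrix with [p] columns is zero below its first [p] rows. *)
Lemma integral_column_reduction (K : fieldType) (p m : nat)
    (X : 'M[laurent K]_(p + m, p)) :
  exists G H : 'M[laurent K]_(p + m), exists T : 'M[laurent K]_p,
    invertible_over_O G H /\ X = H *m col_mx T 0.
Proof.
have [G [H [GH tri]]] := integral_triangularization X.
exists G, H, (usubmx (G *m X)); split=> //.
have <- : G *m X = col_mx (usubmx (G *m X)) 0.
  rewrite -[LHS]vsubmxK; congr col_mx; apply/matrixP => r c.
  by rewrite mxE [RHS]mxE tri //=; have := ltn_ord c; lia.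
by case: GH => _ _ /mulmx1C HG; rewrite mulmxA HG mul1mx.
Qed.

(** * Lattices as images of the standard lattice *)

Lemma mulmx_sum_cols (R : comNzRingType) (m n : nat) (B : 'M[R]_(m, n))
    (x : 'cV[R]_n) : B *m x = \sum_c x c 0 *: col c B.
Proof.
apply/colP => r; rewrite mxE summxE; apply: eq_bigr => c _.
by rewrite !mxE mulrC.
Qed.

(** The generators become the columns of [B], and their independence becomes invertibility.
    Membership in the lattice can then be tested by integrality after applying [invmx B]. *)
Lemma latticeP (K : fieldType) (n : nat) (L : set 'cV[laurent K]_n) :
  is_lattice L <->
  exists2 B : 'M[laurent K]_n, B \in unitmx & L = [set B *m x | x in stdE K n].
Proof.
split=> [[v [v_free ->]]|[B Bu ->]].
  pose B : 'M[laurent K]_n := \matrix_(r, c) tnth v c r 0.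
  have colB c : col c B = tnth v c by apply/colP => r; rewrite !mxE.
  exists B.
    rewrite -unitmx_tr -row_free_unit -kermx_eq0; apply/rowV0P => u /sub_kermxP.
    move=> /(congr1 trmx); rewrite trmx_mul trmxK trmx0 mulmx_sum_cols => uB.
    apply/rowP => c; rewrite [RHS]mxE.
    move/freeP: v_free => /(_ (fun c => u 0 c)); apply; rewrite -[RHS]uB.
    by apply: eq_bigr => i _; rewrite colB mxE -tnth_nth.
  apply/seteqP; split=> [_ [a a0 <-]|_ [x x0 <-]] /=.
    exists (\col_c a c); first by move=> c; rewrite mxE.
    by rewrite mulmx_sum_cols; apply: eq_bigr => c _; rewrite mxE colB.
  exists (fun c => x c 0) => //.
  by rewrite mulmx_sum_cols; apply: eq_bigr => c _; rewrite colB.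
exists [tuple col c B | c < n]; split.
  apply/freeP => a aB c.
  have : B *m (\col_c a c) = 0.
    rewrite mulmx_sum_cols -[RHS]aB; apply: eq_bigr => i _.
    by rewrite mxE -tnth_nth tnth_mktuple.
  move=> /(congr1 (mulmx (invmx B))); rewrite mulKmx // mulmx0.
  by move=> /colP /(_ c); rewrite !mxE.
apply/seteqP; split=> [_ [x x0 <-]|_ [a a0 <-]] /=.
  exists (fun c => x c 0) => //.
  by rewrite mulmx_sum_cols; apply: eq_bigr => c _; rewrite tnth_mktuple.
exists (\col_c a c); first by move=> c; rewrite mxE.
by rewrite mulmx_sum_cols; apply: eq_bigr => c _; rewrite mxE tnth_mktuple.
Qed.

Lemma stdE_integral (K : fieldType) (n : nat) (x : 'cV[laurent K]_n) :
  stdE K n x <-> integral_mx x.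
Proof. by split=> [x0 r c|x0 r]; rewrite ?ord1; apply: x0. Qed.

Lemma lattice_cols (K : fieldType) (m n : nat) (B : 'M[laurent K]_n)
    (A : 'M[laurent K]_(n, m)) : B \in unitmx ->
  (forall c, [set B *m x | x in stdE K n] (col c A)) <->
  integral_mx (invmx B *m A).
Proof.
move=> Bu; split=> [h r c|h c].
  have [x x0 xE] := h c.
  suff -> : (invmx B *m A) r c = x r 0 by exact: x0.
  have -> : x = col c (invmx B *m A) by rewrite colE -mulmxA -colE -xE mulKmx.
  by rewrite [RHS]mxE.
exists (invmx B *m col c A); last by rewrite mulKVmx.
by rewrite colE mulmxA -colE => r; rewrite [col _ _ _ _]mxE; exact: h.
Qed.

Lemma lattice_add (K : fieldType) (n : nat) (L : set 'cV[laurent K]_n) u v :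
  is_lattice L -> L u -> L v -> L (u + v).
Proof.
move=> /latticeP[B Bu ->] [x x0 <-] [y y0 <-]; exists (x + y).
  by move=> r; rewrite mxE; apply: val_geD; [exact: x0|exact: y0].
by rewrite mulmxDr.
Qed.

Lemma sum_set_sym (K : fieldType) (n : nat) (L M : set 'cV[laurent K]_n) :
  sum_set L M = sum_set M L.
Proof.
by apply/seteqP; split=> _ [u Lu [v Mv <-]]; exists v => //; exists u => //;
  rewrite addrC.
Qed.

Lemma lattice0 (K : fieldType) (n : nat) (L : set 'cV[laurent K]_n) :
  is_lattice L -> L 0.
Proof.
move=> /latticeP[B Bu ->]; exists 0; last by rewrite mulmx0.
by move=> r; rewrite mxE.
Qed.

Lemma subset_sum_setl (K : fieldType) (n : nat) (L M : set 'cV[laurent K]_n) :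
  is_lattice M -> L `<=` sum_set L M.
Proof. by move=> /lattice0 M0 u Lu; exists u => //; exists 0 => //; rewrite addr0. Qed.

Lemma subset_sum_setr (K : fieldType) (n : nat) (L M : set 'cV[laurent K]_n) :
  is_lattice L -> M `<=` sum_set L M.
Proof. by rewrite sum_set_sym; exact: subset_sum_setl. Qed.

(** The sum is generated by the columns of [row_mx B C]. Integral column operations, obtained by
    reducing the transpose, turn these into the columns of [T^T] followed by zeros. *)
Lemma lattice_sum (K : fieldType) (n : nat) (L M : set 'cV[laurent K]_n) :
  is_lattice L -> is_lattice M -> is_lattice (sum_set L M).
Proof.
move=> /latticeP[B Bu LE] /latticeP[C Cu ME]; apply/latticeP.
have [G [H [T [[Gi Hi GH] BC]]]] := integral_column_reduction (row_mx B C)^T.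
have {BC} BC : row_mx B C = row_mx T^T 0 *m H^T.
  by rewrite -[LHS]trmxK BC trmx_mul tr_col_mx trmx0.
have BC' : row_mx B C *m G^T = row_mx T^T 0.
  by rewrite BC -mulmxA -trmx_mul GH trmx1 mulmx1.
have tri (m m' : nat) (X : 'M[laurent K]_(m, m')) :
    integral_mx X -> integral_mx X^T by move=> Xi r c; rewrite mxE.
(* [B] factors through [T^T], so [T] inherits a nonzero determinant. *)
have BE : B = T^T *m ulsubmx H^T.
  have : lsubmx (row_mx B C) = lsubmx (row_mx T^T 0 *m H^T) by rewrite BC.
  rewrite row_mxKl => ->; rewrite -[in LHS](submxK H^T) mul_row_block row_mxKl.
  by rewrite mul0mx addr0.
exists T^T.
  move: Bu; rewrite !unitmxE BE det_mulmx !unitfE mulf_eq0 negb_or.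
  by case/andP.
apply/seteqP; split=> [_ [u Lu [v Mv <-]]|_ [x x0 <-]].
  move: Lu Mv; rewrite LE ME => -[x /stdE_integral x0 <-] [y /stdE_integral y0 <-].
  rewrite -mul_row_col BC -mulmxA.
  set z := H^T *m _; have zi : integral_mx z.
    apply: integral_mulmx; first exact: tri.
    by move=> r c; rewrite mxE; case: fintype.split.
  exists (usubmx z); first by apply/stdE_integral => r c; rewrite mxE.
  by rewrite -[in RHS](vsubmxK z) mul_row_col mul0mx addr0.
move/stdE_integral: x0 => x0.
(* The inverse operations [G^T] write [T^T *m x] as an integral combination of the columns of [B]
   and [C]. *)
pose z := G^T *m col_mx x 0; have zi : integral_mx z.
  apply: integral_mulmx; first exact: tri.
  by move=> r c; rewrite mxE; case: fintype.split => // ?; rewrite mxE.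
have zE : T^T *m x = B *m usubmx z + C *m dsubmx z.
  by rewrite -mul_row_col vsubmxK mulmxA BC' mul_row_col mul0mx addr0.
rewrite zE LE ME; exists (B *m usubmx z).
  by exists (usubmx z) => //; apply/stdE_integral => r c; rewrite mxE.
exists (C *m dsubmx z) => //.
by exists (dsubmx z) => //; apply/stdE_integral => r c; rewrite mxE.
Qed.

Lemma lattice_scale_stdE (K : fieldType) (n : nat) (x : laurent K) :
  x != 0 -> is_lattice (scale_set x (stdE K n)).
Proof.
move=> x0; apply/latticeP; exists x%:M.
  by rewrite unitmxE det_scalar unitfE expf_neq0.
by apply/seteqP; split=> _ [v v0 <-]; exists v; rewrite ?mul_scalar_mx.
Qed.

(** * Bounds on lattices and attainment of the determinantal valuation *)

Lemma val_ge_mx_ex (K : fieldType) (m n : nat) (A : 'M[laurent K]_(m, n)) :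
  exists b : nat, forall r c, val_ge (A r c) (- b%:Z).
Proof.
have [b hb] := choice (fun rc : 'I_m * 'I_n => lbndP (A rc.1 rc.2)).
exists (\max_rc b rc)%N => r c k kb; apply: (hb (r, c)).
by have := leq_bigmax (F := b) (r, c); lia.
Qed.

Lemma lattice_bounded (K : fieldType) (n : nat) (L : set 'cV[laurent K]_n) :
  is_lattice L ->
  exists b : nat, forall v, L v -> forall r, val_ge (v r 0) (- b%:Z).
Proof.
move=> /latticeP[B Bu ->]; have [b hb] := val_ge_mx_ex B.
exists b => _ [x x0 <-] r; rewrite mxE; apply: val_ge_sum => c _.
by rewrite -[- _]addr0; apply: val_geM => //; apply: x0.
Qed.

Lemma lattice_absorbing (K : fieldType) (n : nat) (L : set 'cV[laurent K]_n) :
  is_lattice L -> exists b : nat, forall v, stdE K n v ->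
  L (lmonom K b%:Z *: v).
Proof.
move=> /latticeP[B Bu ->]; have [b hb] := val_ge_mx_ex (invmx B).
exists b => v v0; exists (lmonom K b%:Z *: (invmx B *m v)); last first.
  by rewrite -scalemxAr mulKVmx.
move=> r; rewrite mxE; apply: (val_geW (m := b%:Z + (- b%:Z + 0))); first by lia.
apply: val_geM; first exact: val_ge_monom.
rewrite mxE; apply: val_ge_sum => c _; apply: val_geM => //; exact: v0.
Qed.

Notation column_sets s := (flatten [seq nseq p.1 p.2 | p <- s]).

(** Lattices have bounded poles, so the valuations are bounded below; each lattice contains a
    multiple of the standard one, so some determinant is nonzero. *)
Lemma detval_ex (K : fieldType) (n : nat)
    (s : seq (nat * set 'cV[laurent K]_n)) :
  (forall c : 'I_n, is_lattice (nth set0 (column_sets s) c)) ->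
  exists m, (exists2 A, block_columns s A & lead_index (\det A) (- m)) /\
    forall A, block_columns s A -> val_ge (\det A) (- m).
Proof.
move=> lat.
have [b hb] := choice (fun c => lattice_bounded (lat c)).
have [d hd] := choice (fun c => lattice_absorbing (lat c)).
have bnd A : block_columns s A -> val_ge (\det A) (\sum_c - (b c)%:Z).
  move=> As; apply: val_ge_det_col => r c; have := hb c _ (As c) r.
  by rewrite mxE.
(* An admissible matrix with nonzero determinant. *)
pose D : 'M[laurent K]_n := diag_mx (\row_c lmonom K (d c)%:Z).
have Ds : block_columns s D.
  move=> c; have -> : col c D = lmonom K (d c)%:Z *: col c 1%:M.
    by apply/colP => r; rewrite !mxE; case: eqP => [->|_];
      rewrite ?mulr1n ?mulr1 ?mulr0n ?mulr0.
  by apply: hd => r; rewrite mxE; apply: integral_scalar.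
have D0 : \det D != 0.
  rewrite det_diag prodf_seq_neq0; apply/allP => c _ /=; rewrite mxE.
  exact: lmonom_neq0.
(* Offsets from the lower bound [m0] are natural numbers, among which a least one exists. *)
pose m0 := \sum_c - (b c)%:Z.
have lead_m0 A v : block_columns s A -> lead_index (\det A) v ->
    v = m0 + `|v - m0|%N.
  by move=> As Av; have := lead_index_val_ge Av (bnd A As); rewrite -/m0; lia.
pose p (k : nat) := `[< exists2 A, block_columns s A
                                 & lead_index (\det A) (m0 + k%:Z) >].
have ex_p : exists k, p k.
  have [v Dv] := lead_index_ex D0; exists `|v - m0|%N; apply/asboolP.
  by exists D => //; rewrite -(lead_m0 D).
have [k /asboolP[A As Ak] kmin] := ex_minnP ex_p.
exists (- (m0 + k%:Z)); rewrite opprK; split; first by exists A.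
move=> A' A's; have [->|/lead_index_ex[v A'v]] := eqVneq (\det A') 0.
  exact: val_ge0.
have vE := lead_m0 _ _ A's A'v.
have : (k <= `|v - m0|%N)%N.
  by apply: kmin; apply/asboolP; exists A' => //; rewrite -vE.
by move=> kv; apply: val_geW A'v.2; lia.
Qed.

Lemma lvalN_le (K : fieldType) (f : laurent K) m :
  val_ge f (- m) -> (- lval f <= m%:E)%E.
Proof.
move=> fm; have [->|/lead_index_ex[v fv]] := eqVneq f 0.
  by rewrite lval0 /= leNye.
by rewrite (lval_lead fv) /= lee_fin; have := lead_index_val_ge fv fm; lia.
Qed.

(** The working form of [detval]: it trades the maximum in the extended integers for an attained
    leading index and a bound by [val_ge], and rules out the dummy value. *)
Lemma detvalP (K : fieldType) (n : nat)
    (s : seq (nat * set 'cV[laurent K]_n)) :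
  (forall c : 'I_n, is_lattice (nth set0 (column_sets s) c)) ->
  (exists2 A, block_columns s A & lead_index (\det A) (- detval s)) /\
  forall A, block_columns s A -> val_ge (\det A) (- detval s).
Proof.
move=> /detval_ex[m [[A As Am] mub]].
suff -> : detval s = m by split=> //; exists A.
have lAm : (- lval (\det A))%E = m%:E.
  by rewrite (lval_lead Am) /= opprK.
rewrite /detval; case: xgetP => [x _ [[A' A's A'x] xub]|/(_ m)[]].
  have xm : (x%:E <= m%:E)%E by rewrite -A'x; apply/lvalN_le/mub.
  have mx : (m%:E <= x%:E)%E by rewrite -lAm; apply: xub; exists A.
  by apply/eqP; rewrite eq_le; rewrite !lee_fin in xm mx; rewrite xm mx.
by split; [exists A|move=> _ [A' A's <-]; apply/lvalN_le/mub].
Qed.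

Lemma detval_le (K : fieldType) (n : nat)
    (s : seq (nat * set 'cV[laurent K]_n)) m :
  (forall c : 'I_n, is_lattice (nth set0 (column_sets s) c)) ->
  (forall A, block_columns s A -> val_ge (\det A) (- m)) -> detval s <= m.
Proof.
move=> /detvalP[[A As Am] _] /(_ A As) mA.
by have := lead_index_val_ge Am mA; lia.
Qed.

Lemma detval_ge (K : fieldType) (n : nat)
    (s : seq (nat * set 'cV[laurent K]_n)) A m :
  (forall c : 'I_n, is_lattice (nth set0 (column_sets s) c)) ->
  block_columns s A -> lead_index (\det A) (- m) -> m <= detval s.
Proof.
move=> /detvalP[_ ub] /ub mA Am.
by have := lead_index_val_ge Am mA; lia.
Qed.

Lemma lval_sign (K : fieldType) (f : laurent K) (b : bool) :
  lval ((-1) ^+ b * f) = lval f.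
Proof.
case: b; rewrite ?expr0 ?mul1r // expr1 mulN1r.
have [->|/lead_index_ex[v fv]] := eqVneq f 0; first by rewrite oppr0.
rewrite (lval_lead fv); apply: lval_lead; split; last exact: val_geN fv.2.
by rewrite /= oppr_eq0; exact: fv.1.
Qed.

(** Permuting columns changes the determinant only by a sign. *)
Lemma detval_perm (K : fieldType) (n : nat)
    (s1 s2 : seq (nat * set 'cV[laurent K]_n)) :
  size (column_sets s2) = n ->
  perm_eq (column_sets s1) (column_sets s2) -> detval s1 = detval s2.
Proof.
move=> sz2 p12.
suff sub (t1 t2 : seq (nat * set 'cV[laurent K]_n)) :
    size (column_sets t2) = n -> perm_eq (column_sets t1) (column_sets t2) ->
    [set (- lval (\det A))%E | A in block_columns t1] `<=`
    [set (- lval (\det A))%E | A in block_columns t2].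
  rewrite /detval; suff -> : [set (- lval (\det A))%E | A in block_columns s1] =
    [set (- lval (\det A))%E | A in block_columns s2] by [].
  apply/seteqP; split; apply: sub => //; last by rewrite perm_sym.
  by rewrite (perm_size p12).
move=> szt p _ [A At1 <-].
have /tuple_permP[q qE] : perm_eq (column_sets t1) (Tuple (introT eqP szt)).
  by [].
exists (col_perm q^-1%g A); last first.
  by rewrite col_permE det_mulmx det_perm mulrC lval_sign.
move=> c; have := At1 (q^-1 c)%g; rewrite qE.
rewrite -tnth_nth tnth_mktuple permKV (tnth_nth set0) /=.
by congr (_ _); apply/colP => r; rewrite !mxE.
Qed.

Lemma nth_column_sets1 (K : fieldType) (n : nat) (P : set 'cV[laurent K]_n)
    (c : 'I_n) : nth set0 (column_sets [:: (n, P)]) c = P.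
Proof. by rewrite /= cats0 nth_nseq ltn_ord. Qed.

Lemma nth_column_sets2 (K : fieldType) (n p m : nat)
    (L P : set 'cV[laurent K]_n) (c : 'I_n) : (p + m)%N = n ->
  nth set0 (column_sets [:: (p, L); (m, P)]) c = if (c < p)%N then L else P.
Proof.
move=> e; rewrite /= cats0 nth_cat size_nseq !nth_nseq; have := ltn_ord c.
by case: (ltnP c p) => // pc cn; rewrite ifT //; lia.
Qed.

Lemma nth_column_sets3 (K : fieldType) (n i j k : nat)
    (L M N : set 'cV[laurent K]_n) (c : 'I_n) : (i + j + k)%N = n ->
  nth set0 (column_sets [:: (i, L); (j, M); (k, N)]) c =
  if (c < i)%N then L else if (c < i + j)%N then M else N.
Proof.
move=> e; rewrite /= cats0 !nth_cat !size_nseq !nth_nseq; have := ltn_ord c.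
case: (ltnP c i) => // ic cn; have -> : (c - i < j)%N = (c < i + j)%N by lia.
by case: (ltnP c (i + j)) => // jc; rewrite ifT //; lia.
Qed.

(** * Factoring columns through a lattice: the upper bound *)

(** A matrix with columns in [P] is [B] times an integral matrix, so no determinant has smaller
    valuation than that of [B], which is itself admissible. *)
Lemma lead_index_detval (K : fieldType) (n : nat) (B : 'M[laurent K]_n)
    (P : set 'cV[laurent K]_n) :
  B \in unitmx -> P = [set B *m x | x in stdE K n] ->
  lead_index (\det B) (- detval [:: (n, P)]).
Proof.
move=> Bu PE; have Plat : is_lattice P by apply/latticeP; exists B.
have [|[A As Am] ub] := @detvalP K n [:: (n, P)].
  by move=> c; rewrite nth_column_sets1.
have B0 : \det B != 0 by rewrite -unitfE -unitmxE.
have [b Bb] := lead_index_ex B0.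
have Ci : integral_mx (invmx B *m A).
  apply/lattice_cols => // c; have := As c; rewrite nth_column_sets1 PE.
  by [].
have AE : \det A = \det B * \det (invmx B *m A).
  by rewrite -det_mulmx mulKVmx.
have bA : val_ge (\det A) b.
  rewrite AE -[b]addr0; apply: val_geM; first exact: Bb.2.
  exact: integral_det.
have Bs : block_columns [:: (n, P)] B.
  move=> c; rewrite nth_column_sets1 PE; move: c; apply/lattice_cols => //.
  by rewrite mulVmx //; exact: integral_scalar.
suff <- : b = - detval [:: (n, P)] by [].
apply/eqP; rewrite eq_le (lead_index_val_ge Am bA).
exact: lead_index_val_ge Bb (ub _ Bs).
Qed.

(** Reducing [invmx B *m X] replaces the basis matrix [B] of [P] by another one, [B *m H], whose
    first [p] columns alone express [X]; they form [Q]. *)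
Lemma lattice_factor (K : fieldType) (n p m : nat) (L P : set 'cV[laurent K]_n)
    (X : 'M[laurent K]_(n, p)) :
  (p + m)%N = n -> is_lattice L -> is_lattice P -> (forall c, L (col c X)) ->
  exists Q : 'M[laurent K]_(n, p), exists T : 'M[laurent K]_p,
    [/\ forall c, P (col c Q), X = Q *m T
      & val_ge (\det T) (detval [:: (n, P)] - detval [:: (p, L); (m, P)])].
Proof.
move=> e; case: _ / e in L P X *; move=> Llat Plat XL.
have /latticeP[B Bu PE] := Plat.
have [G [H [T [GH XE]]]] := integral_column_reduction (invmx B *m X).
have BHi : integral_mx (invmx B *m (B *m H)) by rewrite mulKmx //; case: GH.
have BHP : forall c, P (col c (B *m H)) by rewrite PE; apply/lattice_cols.
have XE' : X = B *m H *m col_mx T 0 by rewrite -mulmxA -XE mulKVmx.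
exists (lsubmx (B *m H)), T; split.
- move=> c; have -> : col c (lsubmx (B *m H)) = col (lshift m c) (B *m H).
    by apply/colP => r; rewrite !mxE.
  exact: BHP.
- by rewrite XE' -{1}[B *m H]hsubmxK mul_row_col mulmx0 addr0.
(* Completing [X] by the other basis vectors gives a competitor for the pair of lattices, with
   determinant [\det T * \det (B *m H)]; cancelling the last factor bounds [\det T]. *)
pose A := row_mx X (rsubmx (B *m H)).
have As : block_columns [:: (p, L); (m, P)] A.
  move=> c; rewrite nth_column_sets2 //; case: (split_ordP c) => c' ->.
    have -> : col (lshift m c') A = col c' X.
      by apply/colP => r; rewrite !mxE (unsplitK (inl _)).
    exact: XL.
  have -> : col (rshift p c') A = col (rshift p c') (B *m H).
    by apply/colP => r; rewrite !mxE (unsplitK (inr _)) mxE mxE.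
  exact: BHP.
have [|_ ub] := @detvalP K _ [:: (p, L); (m, P)].
  by move=> c; rewrite nth_column_sets2 //; case: ifP.
have AE : A = B *m H *m block_mx T 0 0 1%:M.
  rewrite -{1}[B *m H]hsubmxK mul_row_block !mulmx0 addr0 add0r mulmx1.
  by rewrite /A XE' -{1}[B *m H]hsubmxK mul_row_col mulmx0 addr0.
apply: (@val_ge_mulr_cancel _ _ (\det (B *m H)) _ (- detval [:: ((p + m)%N, P)])).
  rewrite det_mulmx -[- _]addr0; apply: lead_indexM.
    exact: lead_index_detval.
  exact: lead_index_det_invertible GH.
have -> : \det T * \det (B *m H) = \det A.
  by rewrite AE [RHS]det_mulmx det_ublock det1 mulr1 mulrC.
by have := ub _ As; rewrite addrAC subrr add0r.
Qed.

(* Factoring each block of columns as [Q *m T] with the columns of [Q] in [P]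
   splits the determinant into four factors whose valuations are controlled
   separately. *)
Lemma detval_le_via (K : fieldType) (n i j k : nat)
    (L M N P : set 'cV[laurent K]_n) :
  (i + j + k)%N = n -> is_lattice L -> is_lattice M -> is_lattice N ->
  is_lattice P ->
  detval [:: (i, L); (j, M); (k, N)] <=
  detval [:: (i, L); ((j + k)%N, P)] + detval [:: (j, M); ((i + k)%N, P)]
    + detval [:: (k, N); ((i + j)%N, P)] - 2 * detval [:: (n, P)].
Proof.
move=> e Llat Mlat Nlat Plat; apply: detval_le => [c|A As].
  by rewrite nth_column_sets3 //; do 2?case: ifP.
have e1 : (i + (j + k))%N = n by lia.
have e2 : (j + (i + k))%N = n by lia.
have e3 : (k + (i + j))%N = n by lia.
case: _ / e in L M N P A As Llat Mlat Nlat Plat e1 e2 e3 *.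
have {}As c := As c; pose X := lsubmx (lsubmx A).
pose Y := rsubmx (lsubmx A); pose Z := rsubmx A.
have XL c : L (col c X).
  have := As (lshift k (lshift j c)); rewrite nth_column_sets3 // /= ltn_ord.
  by congr (L _); apply/colP => r; rewrite !mxE.
have YM c : M (col c Y).
  have := As (lshift k (rshift i c)); rewrite nth_column_sets3 //=.
  rewrite ltnNge leq_addr ltn_add2l ltn_ord /=.
  by congr (M _); apply/colP => r; rewrite !mxE.
have ZN c : N (col c Z).
  have := As (rshift (i + j) c); rewrite nth_column_sets3 //=.
  rewrite ifF; last by lia.
  rewrite ifF; last by lia.
  by congr (N _); apply/colP => r; rewrite !mxE.
have [Q1 [T1 [Q1P XE T1v]]] := lattice_factor e1 Llat Plat XL.
have [Q2 [T2 [Q2P YE T2v]]] := lattice_factor e2 Mlat Plat YM.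
have [Q3 [T3 [Q3P ZE T3v]]] := lattice_factor e3 Nlat Plat ZN.
pose Q := row_mx (row_mx Q1 Q2) Q3.
have Qs : block_columns [:: ((i + j + k)%N, P)] Q.
  move=> c; rewrite nth_column_sets1; case: (split_ordP c) => c' ->.
    have -> : col (lshift k c') Q = col c' (row_mx Q1 Q2).
      by apply/colP => r; rewrite !mxE (unsplitK (inl _)) mxE.
    case: (split_ordP c') => c2 ->.
      have -> : col (lshift j c2) (row_mx Q1 Q2) = col c2 Q1.
        by apply/colP => r; rewrite !mxE (unsplitK (inl _)).
      exact: Q1P.
    have -> : col (rshift i c2) (row_mx Q1 Q2) = col c2 Q2.
      by apply/colP => r; rewrite !mxE (unsplitK (inr _)).
    exact: Q2P.
  have -> : col (rshift (i + j) c') Q = col c' Q3.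
    by apply/colP => r; rewrite !mxE (unsplitK (inr _)).
  exact: Q3P.
have [|_ /(_ _ Qs) Qv] := @detvalP K _ [:: ((i + j + k)%N, P)].
  by move=> c; rewrite nth_column_sets1.
have AE : A = Q *m block_mx (block_mx T1 0 0 T2) 0 0 T3.
  rewrite mul_row_block !mulmx0 addr0 add0r mul_row_block !mulmx0 addr0 add0r.
  by rewrite -XE -YE -ZE !hsubmxK.
rewrite AE det_mulmx !det_ublock.
(* [Q] contributes the term in [P] alone once with a minus sign and each [T] once with a plus sign,
   which leaves the coefficient 2. *)
have := val_geM Qv (val_geM (val_geM T1v T2v) T3v).
by apply: val_geW; lia.
Qed.

(** * Bounds when a multiple of one lattice lies in another *)

Lemma sum_prefix (n p : nat) (x : int) : (p <= n)%N ->
  \sum_(c < n) (if (c < p)%N then x else 0) = x * p%:Z.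
Proof.
move=> pn; rewrite -big_mkcond /= -(big_ord_widen n (fun=> x)) //.
by rewrite sumr_const card_ord -mulr_natr natz.
Qed.

(** In coordinates of [P] each of the [p] columns from [L] has poles of order at most [a], and the
    remaining columns are integral. *)
Lemma detval_scaled_le (K : fieldType) (n p m a : nat)
    (L P : set 'cV[laurent K]_n) :
  (p + m)%N = n -> is_lattice L -> is_lattice P ->
  (forall v, L v -> P (lmonom K a%:Z *: v)) ->
  detval [:: (p, L); (m, P)] <= (a * p)%N%:Z + detval [:: (n, P)].
Proof.
move=> e Llat Plat LP; apply: detval_le => [c|A As].
  by rewrite nth_column_sets2 //; case: ifP.
have /latticeP[B Bu PE] := Plat.
have -> : \det A = \det B * \det (invmx B *m A).
  by rewrite -det_mulmx mulKVmx.
apply: (val_geW (m := - detval [:: (n, P)] +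
    \sum_(c < n) (if (c < p)%N then - a%:Z else 0))).
  by rewrite sum_prefix -?e ?leq_addr //; lia.
apply: val_geM; first exact: (lead_index_detval Bu PE).2.
apply: val_ge_det_col => r c.
have -> : (invmx B *m A) r c = (invmx B *m col c A) r 0.
  by rewrite colE mulmxA -colE [RHS]mxE.
have := As c; rewrite nth_column_sets2 //; case: ifP => _; last first.
  by rewrite PE => -[x x0 <-]; rewrite mulKmx //; exact: x0.
move=> /LP; rewrite PE => -[x x0 xE].
have -> : col c A = lmonom K (- a%:Z) *: (B *m x).
  by rewrite xE scalerA -lmonomD addNr scale1r.
rewrite -scalemxAr mulKmx // mxE -[X in val_ge _ X]addr0; apply: val_geM; last exact: x0.
exact: val_ge_monom.
Qed.

(** * Constant matrices and residues *)

Lemma lconst_proof (K : fieldType) (x : K) :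
  exists N : int, forall m : int, m < N -> x *+ (m == 0) = 0.
Proof. by exists 0 => m m0; rewrite lt_eqF. Qed.

Definition lconst (K : fieldType) (x : K) : laurent K :=
  Laurent (lconst_proof x).

Lemma val_ge_lconst (K : fieldType) (x : K) : val_ge (lconst x) 0.
Proof. by move=> m m0 /=; rewrite lt_eqF. Qed.

Lemma integral_lconst (K : fieldType) (m n : nat) (A : 'M[K]_(m, n)) :
  integral_mx (map_mx (@lconst K) A).
Proof. by move=> r c; rewrite mxE; exact: val_ge_lconst. Qed.

Lemma map_lconstK (K : fieldType) (m n : nat) (A : 'M[K]_(m, n)) :
  map_mx (fun f : laurent K => f 0) (map_mx (@lconst K) A) = A.
Proof. by apply/matrixP => r c; rewrite !mxE. Qed.

Lemma lead_index_det_lconst (K : fieldType) (n : nat) (G : 'M[K]_n) :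
  G \in unitmx -> lead_index (\det (map_mx (@lconst K) G)) 0.
Proof.
move=> Gu; split; last exact: integral_det (@integral_lconst _ _ _ _).
rewrite lcoef0_det; last exact: integral_lconst.
by rewrite map_lconstK -unitfE -unitmxE.
Qed.

(** For columns in t^-1 E these are their classes in t^-1 E / E, identified with K^n. *)
Definition residue_mx (K : fieldType) (m n : nat) (A : 'M[laurent K]_(m, n)) :
  'M[K]_(m, n) := map_mx (fun f : laurent K => f (-1)) A.

Definition simple_pole_mx (K : fieldType) (m n : nat)
  (A : 'M[laurent K]_(m, n)) := forall r c, val_ge (A r c) (-1).

Lemma residue_mulmxl (K : fieldType) (m n p : nat) (G : 'M[laurent K]_(m, n))
    (A : 'M[laurent K]_(n, p)) : integral_mx G -> simple_pole_mx A ->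
  residue_mx (G *m A) = map_mx (fun f : laurent K => f 0) G *m residue_mx A.
Proof.
move=> G0 A1; apply/matrixP => r c; rewrite !mxE lcoef_sum.
apply: eq_bigr => s _; rewrite !mxE.
by rewrite -[X in (_ * _ : laurent K) X]add0r lcoefM_lead.
Qed.

Lemma residue_mulmxr (K : fieldType) (m n p : nat) (A : 'M[laurent K]_(m, n))
    (G : 'M[laurent K]_(n, p)) : simple_pole_mx A -> integral_mx G ->
  residue_mx (A *m G) = residue_mx A *m map_mx (fun f : laurent K => f 0) G.
Proof.
move=> A1 G0; apply/matrixP => r c; rewrite !mxE lcoef_sum.
apply: eq_bigr => s _; rewrite !mxE.
by rewrite -[X in (_ * _ : laurent K) X]addr0 lcoefM_lead.
Qed.

Lemma val_ge_simple_pole (K : fieldType) (f : laurent K) :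
  val_ge f (-1) -> f (-1) = 0 -> val_ge f 0.
Proof.
move=> f1 f0 k k0; have [|k1] := ltP k (-1); first exact: f1.
by have -> : k = -1 by lia.
Qed.

(** Constant row operations leave only as many rows with a pole as the rank of the residue matrix;
    the other rows become integral. *)
Lemma val_ge_det_residue (K : fieldType) (n : nat) (A : 'M[laurent K]_n) :
  simple_pole_mx A -> val_ge (\det A) (- (\rank (residue_mx A))%:Z).
Proof.
move=> A1; set R := residue_mx A.
(* Multiplying [R] by this inverse leaves [pid_mx (\rank R) *m row_ebase R], whose rows beyond the
   rank are zero. *)
pose G := invmx (col_ebase R); pose G' := map_mx (@lconst K) G.
have Gu : G \in unitmx by rewrite unitmx_inv col_ebase_unit.
have GA1 : simple_pole_mx (G' *m A).
  by move=> r c; apply: val_ge_mulmx => // s; exact: integral_lconst.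
have GAres : residue_mx (G' *m A) = pid_mx (\rank R) *m row_ebase R.
  rewrite residue_mulmxl //; last exact: integral_lconst.
  rewrite map_lconstK -/R -{1}[R]mulmx_ebase -[col_ebase _ *m _ *m _]mulmxA.
  by rewrite mulKmx ?col_ebase_unit.
apply: (val_ge_mulr_cancel (lead_index_det_lconst Gu)).
rewrite mulrC -det_mulmx addr0 -/G'.
have -> : - (\rank R)%:Z =
    \sum_(r < n) (if (r < \rank R)%N then -1 else 0) :> int.
  by rewrite sum_prefix ?rank_leq_row // mulN1r.
apply: val_ge_det => r c; case: ltnP => [_|rR]; first exact: GA1.
apply: val_ge_simple_pole; first exact: GA1.
have /matrixP /(_ r c) := GAres; rewrite [LHS]mxE => ->.
rewrite mxE big1 // => s _; rewrite mxE (ltnNge r) rR andbF.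
by rewrite mul0r.
Qed.

(** [P] lies in t^-1 E and its image in the quotient by E lies in the row space of [D]; the
    transpose is there because subspaces are row spaces. *)
Definition residues_in (K : fieldType) (n : nat) (P : set 'cV[laurent K]_n)
    (D : 'M[K]_n) :=
  forall v, P v -> simple_pole_mx v /\ ((residue_mx v)^T <= D)%MS.

Lemma detval_residue_le (K : fieldType) (n : nat) (P : set 'cV[laurent K]_n)
    (D : 'M[K]_n) :
  is_lattice P -> residues_in P D -> detval [:: (n, P)] <= (\rank D)%:Z.
Proof.
move=> Plat PD; apply: detval_le => [c|A As]; first by rewrite nth_column_sets1.
have {}As c : P (col c A) by have := As c; rewrite nth_column_sets1.
have A1 : simple_pole_mx A.
  by move=> r c; have [/(_ r 0)] := PD _ (As c); rewrite mxE.
apply: val_geW (val_ge_det_residue A1); rewrite lerN2 lez_nat.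
rewrite -mxrank_tr mxrankS //; apply/row_subP => c.
have -> : row c (residue_mx A)^T = (residue_mx (col c A))^T.
  by apply/rowP => r; rewrite !mxE.
exact: (PD _ (As c)).2.
Qed.

Lemma residues_in_sum (K : fieldType) (n : nat) (L M : set 'cV[laurent K]_n)
    (D D' : 'M[K]_n) : residues_in L D -> residues_in M D' ->
  residues_in (sum_set L M) (D + D')%MS.
Proof.
move=> LD MD _ [u Lu [v Mv <-]].
have [u1 uD] := LD _ Lu; have [v1 vD] := MD _ Mv; split.
  by move=> r c; rewrite mxE; apply: val_geD.
have -> : (residue_mx (u + v))^T = (residue_mx u)^T + (residue_mx v)^T.
  by apply/matrixP => r c; rewrite !mxE.
by rewrite addmx_sub_adds.
Qed.

(** Residues of a basis span the image of [L] in t^-1 E / E, and [L] is the full preimage of that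
    image because it contains E. *)
Lemma residue_space_ex (K : fieldType) (n : nat) (L : set 'cV[laurent K]_n) :
  is_lattice L -> stdE K n `<=` L ->
  L `<=` scale_set (tvar K)^-1 (stdE K n) ->
  exists D : 'M[K]_n, residues_in L D /\
    forall x : 'rV[K]_n, (x <= D)%MS ->
      L ((tvar K)^-1 *: map_mx (@lconst K) x^T).
Proof.
move=> Llat EL LE; have /latticeP[B Bu LB] := Llat.
have L1 v : L v -> simple_pole_mx v.
  move=> /LE[w w0 <-] r c; rewrite ord1 mxE tvarV -[X in val_ge _ X]addr0.
  by apply: val_geM; [exact: val_ge_monom | exact: w0].
have B1 : simple_pole_mx B.
  move=> r c; have : L (col c B).
    rewrite LB; move: c; apply/lattice_cols => //.
    by rewrite mulVmx //; exact: integral_scalar.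
  by move=> /L1 /(_ r 0); rewrite mxE.
exists (residue_mx B)^T; split=> [v Lv|x /submxP[y xE]].
  split; first exact: L1.
  move: Lv; rewrite LB => -[z z0 <-].
  by rewrite residue_mulmxr ?trmx_mul ?submxMl //; apply/stdE_integral.
pose z := map_mx (@lconst K) y^T.
have zi : integral_mx z by exact: integral_lconst.
(* The residues cancel in this difference, so it lies in E and hence in [L]. *)
pose w := (tvar K)^-1 *: map_mx (@lconst K) x^T - B *m z.
have -> : (tvar K)^-1 *: map_mx (@lconst K) x^T = w + B *m z by rewrite subrK.
apply: lattice_add => //; last by rewrite LB; exists z => //; apply/stdE_integral.
apply: EL; apply/stdE_integral => r c.
have x1 : simple_pole_mx ((tvar K)^-1 *: map_mx (@lconst K) x^T).
  move=> r' c'; rewrite !mxE tvarV -[X in val_ge _ X]addr0.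
  by apply: val_geM; [exact: val_ge_monom | exact: val_ge_lconst].
have Bz1 : simple_pole_mx (B *m z).
  move=> r' c'; rewrite mxE; apply: val_ge_sum => s _.
  by rewrite -[X in val_ge _ X]addr0; apply: val_geM.
apply: val_ge_simple_pole; rewrite mxE.
  by apply: val_geD; [exact: x1|rewrite mxE; apply: val_geN].
rewrite lcoefD; have -> : ((- (B *m z)) r c) (-1) = - residue_mx (B *m z) r c.
  by rewrite !mxE.
rewrite residue_mulmxr // map_lconstK -[residue_mx B]trmxK -trmx_mul -xE !mxE.
by rewrite tvarV lcoef_monomM subrr.
Qed.

(** * The lower bound from independent residues *)

Lemma lmonom_sum (K : fieldType) (I : Type) (r : seq I) (w : I -> int) :
  lmonom K (\sum_(i <- r) w i) = \prod_(i <- r) lmonom K (w i).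
Proof. by apply: big_morph => [x y|]; first exact: lmonomD. Qed.

Lemma lead_index_monom (K : fieldType) d : lead_index (lmonom K d) d.
Proof. by split; [rewrite /= eqxx oner_eq0|exact: val_ge_monom]. Qed.

(** The witness has the rows of [Y] as constant columns, divided by t for indices in [J]; its
    determinant is a nonzero constant times t to the power [- #|J|]. *)
Lemma detval_ge_card (K : fieldType) (n : nat)
    (s : seq (nat * set 'cV[laurent K]_n)) (J : {set 'I_n}) (Y : 'M[K]_n) :
  (forall c : 'I_n, is_lattice (nth set0 (column_sets s) c)) ->
  (forall c : 'I_n, stdE K n `<=` nth set0 (column_sets s) c) ->
  (forall c : 'I_n, c \in J -> nth set0 (column_sets s) c
     ((tvar K)^-1 *: map_mx (@lconst K) (row c Y)^T)) ->
  Y \in unitmx -> #|J|%:Z <= detval s.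
Proof.
move=> lat Es Js Yu; pose w c : int := if c \in J then -1 else 0.
pose A := map_mx (@lconst K) Y^T *m diag_mx (\row_c lmonom K (w c)).
have colA c : col c A = lmonom K (w c) *: map_mx (@lconst K) (row c Y)^T.
  apply/colP => r; rewrite /A mul_mx_diag !mxE mulrC.
  by [].
apply: (@detval_ge _ _ _ A) => // [c|].
  rewrite colA /w; case: ifP => [/Js|_]; first by rewrite tvarV.
  rewrite scale1r; apply: Es; apply/stdE_integral; exact: integral_lconst.
have -> : - #|J|%:Z = 0 + \sum_c w c.
  rewrite add0r /w -big_mkcond /= sumr_const mulNrn.
  by congr (- _); rewrite natz.
rewrite det_mulmx det_diag; apply: lead_indexM.
  by apply: lead_index_det_lconst; rewrite unitmx_tr.
rewrite (eq_bigr (fun c => lmonom K (w c))); last by move=> c _; rewrite mxE.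
by rewrite -lmonom_sum; exact: lead_index_monom.
Qed.

Lemma detval_ge_rado (K : fieldType) (n i j k h : nat)
    (L M N : set 'cV[laurent K]_n) (A B C : 'M[K]_n) :
  (i + j + k)%N = n -> is_lattice L -> is_lattice M -> is_lattice N ->
  stdE K n `<=` L -> stdE K n `<=` M -> stdE K n `<=` N ->
  (forall x : 'rV_n, (x <= A)%MS -> L ((tvar K)^-1 *: map_mx (@lconst K) x^T)) ->
  (forall x : 'rV_n, (x <= B)%MS -> M ((tvar K)^-1 *: map_mx (@lconst K) x^T)) ->
  (forall x : 'rV_n, (x <= C)%MS -> N ((tvar K)^-1 *: map_mx (@lconst K) x^T)) ->
  (forall b, (h <= rado_bound i j k A B C b)%N) ->
  h%:Z <= detval [:: (i, L); (j, M); (k, N)].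
Proof.
move=> e Llat Mlat Nlat EL EM EN AL BM CN hb.
have [S|J [Y [Yu YJ hJ]]] := @basis_transversal K n
    (fun c => if (c < i)%N then A else if (c < i + j)%N then B else C) h.
  by have [b] := rado_bound_le A B C S e; apply: leq_trans.
apply: (@le_trans _ _ #|J|%:Z); first by rewrite lez_nat.
apply: detval_ge_card Yu => c; rewrite nth_column_sets3 //.
- by do 2?case: ifP.
- by do 2?case: ifP.
by move=> /YJ; do 2?case: ifP => _ //; [exact: AL|exact: BM|exact: CN].
Qed.

(** * The eight lattices and the minimum formula *)

(** Each of the three mixed terms costs one [detval [:: (n, P)]], and two of these are
    subtracted. *)
Lemma detval_via_le (K : fieldType) (n i j k a b c : nat)
    (L M N P : set 'cV[laurent K]_n) :
  (i + j + k)%N = n -> is_lattice L -> is_lattice M -> is_lattice N ->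
  is_lattice P ->
  (forall v, L v -> P (lmonom K a%:Z *: v)) ->
  (forall v, M v -> P (lmonom K b%:Z *: v)) ->
  (forall v, N v -> P (lmonom K c%:Z *: v)) ->
  detval [:: (i, L); ((j + k)%N, P)] + detval [:: (j, M); ((i + k)%N, P)]
    + detval [:: (k, N); ((i + j)%N, P)] - 2 * detval [:: (n, P)] <=
  (a * i + b * j + c * k)%N%:Z + detval [:: (n, P)].
Proof.
move=> e Llat Mlat Nlat Plat LP MP NP.
have e1 : (i + (j + k))%N = n by lia.
have e2 : (j + (i + k))%N = n by lia.
have e3 : (k + (i + j))%N = n by lia.
have := detval_scaled_le e1 Llat Plat LP.
have := detval_scaled_le e2 Mlat Plat MP.
have := detval_scaled_le e3 Nlat Plat NP.
by lia.
Qed.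

(** Both sides list the same column lattices up to order; this identifies the two forms of the
    minimum. *)
Lemma detval_regroup (K : fieldType) (n i j k : nat)
    (L M N P : set 'cV[laurent K]_n) : (i + j + k)%N = n ->
  [/\ detval [:: (i, L); (j, P); (k, P)] = detval [:: (i, L); ((j + k)%N, P)],
      detval [:: (i, P); (j, M); (k, P)] = detval [:: (j, M); ((i + k)%N, P)],
      detval [:: (i, P); (j, P); (k, N)] = detval [:: (k, N); ((i + j)%N, P)]
    & detval [:: (i, P); (j, P); (k, P)] = detval [:: (n, P)]].
Proof.
move=> e; have nseqD a b (X : set 'cV[laurent K]_n) :
    nseq (a + b) X = nseq a X ++ nseq b X.
  by elim: a => //= a ->.
split; apply: detval_perm; rewrite /= ?cats0 ?size_cat ?size_nseq //;
  rewrite ?nseqD; try lia.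
- by rewrite !catA.
- by rewrite perm_catCA.
- by rewrite catA perm_catC.
have -> : nseq n P = nseq (i + j + k) P by rewrite e.
by rewrite !nseqD catA.
Qed.

(** [P] is the sum of the lattices selected by [b]. Selected lattices lie in [P] and cost nothing;
    an unselected one enters [P] after multiplication by t and costs its multiplicity. The residues
    of [P] account for the rank in [rado_bound]. *)
Lemma eight_lattices (K : fieldType) (n i j k : nat)
    (L M N : set 'cV[laurent K]_n) (A B C : 'M[K]_n) (b : bool * bool * bool) :
  (i + j + k)%N = n -> is_lattice L -> is_lattice M -> is_lattice N ->
  stdE K n `<=` L -> stdE K n `<=` M -> stdE K n `<=` N ->
  L `<=` scale_set (tvar K)^-1 (stdE K n) ->
  M `<=` scale_set (tvar K)^-1 (stdE K n) ->
  N `<=` scale_set (tvar K)^-1 (stdE K n) ->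
  residues_in L A -> residues_in M B -> residues_in N C ->
  exists P : set 'cV[laurent K]_n,
    [/\ P = scale_set (tvar K) (stdE K n) \/
        [\/ P = L, P = M | P = N] \/
        [\/ P = sum_set L M, P = sum_set L N, P = sum_set M N
          | P = sum_set (sum_set L M) N],
        is_lattice P
      & detval [:: (i, L); ((j + k)%N, P)] + detval [:: (j, M); ((i + k)%N, P)]
        + detval [:: (k, N); ((i + j)%N, P)] - 2 * detval [:: (n, P)]
        <= (rado_bound i j k A B C b)%:Z].
Proof.
move=> e Llat Mlat Nlat EL EM EN LE ME NE LA MB NC.
have sc0 (X P : set 'cV[laurent K]_n) : X `<=` P ->
    forall v, X v -> P (lmonom K 0%N%:Z *: v).
  by move=> XP v /XP; rewrite scale1r.
have sc1 (X P : set 'cV[laurent K]_n) :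
    X `<=` scale_set (tvar K)^-1 (stdE K n) -> stdE K n `<=` P ->
    forall v, X v -> P (lmonom K 1%N%:Z *: v).
  move=> XE EP v /XE[w w0 <-]; apply: EP.
  by rewrite tvarV scalerA -lmonomD scale1r.
have sc2 (X : set 'cV[laurent K]_n) :
    X `<=` scale_set (tvar K)^-1 (stdE K n) ->
    forall v, X v -> scale_set (tvar K) (stdE K n) (lmonom K 2%N%:Z *: v).
  move=> XE v /XE[w w0 <-]; exists w => //.
  by rewrite tvarV scalerA -lmonomD.
have LMlat := lattice_sum Llat Mlat.
have LNlat := lattice_sum Llat Nlat.
have MNlat := lattice_sum Mlat Nlat.
have Slat := lattice_sum LMlat Nlat.
have L_LM : L `<=` sum_set L M := subset_sum_setl Mlat.
have M_LM : M `<=` sum_set L M := subset_sum_setr Llat.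
have L_LN : L `<=` sum_set L N := subset_sum_setl Nlat.
have N_LN : N `<=` sum_set L N := subset_sum_setr Llat.
have M_MN : M `<=` sum_set M N := subset_sum_setl Nlat.
have N_MN : N `<=` sum_set M N := subset_sum_setr Mlat.
have LM_S : sum_set L M `<=` sum_set (sum_set L M) N := subset_sum_setl Nlat.
have N_S : N `<=` sum_set (sum_set L M) N := subset_sum_setr LMlat.
have L_S := subset_trans L_LM LM_S; have M_S := subset_trans M_LM LM_S.
have E_LM := subset_trans EL L_LM; have E_LN := subset_trans EL L_LN.
have E_MN := subset_trans EM M_MN.
have bound P a1 a2 a3 (D : 'M[K]_n) : is_lattice P ->
    (forall v, L v -> P (lmonom K a1%:Z *: v)) ->
    (forall v, M v -> P (lmonom K a2%:Z *: v)) ->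
    (forall v, N v -> P (lmonom K a3%:Z *: v)) ->
    residues_in P D -> (a1 * i + a2 * j + a3 * k + \rank D <=
      rado_bound i j k A B C b)%N ->
    detval [:: (i, L); ((j + k)%N, P)] + detval [:: (j, M); ((i + k)%N, P)]
      + detval [:: (k, N); ((i + j)%N, P)] - 2 * detval [:: (n, P)]
      <= (rado_bound i j k A B C b)%:Z.
  move=> Plat LP MP NP PD.
  have := detval_via_le e Llat Mlat Nlat Plat LP MP NP.
  by have := detval_residue_le Plat PD; lia.
case: b bound => [[[] []] []] bound.
- exists (sum_set (sum_set L M) N); split; [by right; right; constructor|by []|].
  apply: (bound _ 0 0 0 _ Slat (sc0 _ _ _) (sc0 _ _ _) (sc0 _ _ _)
    (residues_in_sum (residues_in_sum LA MB) NC))%N => //.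
  by rewrite /rado_bound /= !muln0.
- exists (sum_set L M); split; [by right; right; constructor|by []|].
  apply: (bound _ 0 0 1 _ LMlat (sc0 _ _ _) (sc0 _ _ _) (sc1 _ _ _ _)
    (residues_in_sum LA MB))%N => //.
  by rewrite /rado_bound /= !muln0 addsmx0 mul1n muln1.
- exists (sum_set L N); split; [by right; right; constructor|by []|].
  apply: (bound _ 0 1 0 _ LNlat (sc0 _ _ _) (sc1 _ _ _ _) (sc0 _ _ _)
    (residues_in_sum LA NC))%N => //.
  by rewrite /rado_bound /= !muln0 !addn0 mul1n muln1 addsmx0_id.
- exists L; split; [by right; left; constructor|by []|].
  apply: (bound _ 0 1 1 _ Llat (sc0 _ _ _) (sc1 _ _ _ _) (sc1 _ _ _ _) LA)%N
    => //.
  by rewrite /rado_bound /= !addsmx0; lia.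
- exists (sum_set M N); split; [by right; right; constructor|by []|].
  apply: (bound _ 1 0 0 _ MNlat (sc1 _ _ _ _) (sc0 _ _ _) (sc0 _ _ _)
    (residues_in_sum MB NC))%N => //.
  by rewrite /rado_bound /= adds0mx_id; lia.
- exists M; split; [by right; left; constructor|by []|].
  apply: (bound _ 1 0 1 _ Mlat (sc1 _ _ _ _) (sc0 _ _ _) (sc1 _ _ _ _) MB)%N
    => //.
  by rewrite /rado_bound /= addsmx0 adds0mx; lia.
- exists N; split; [by right; left; constructor|by []|].
  apply: (bound _ 1 1 0 _ Nlat (sc1 _ _ _ _) (sc1 _ _ _ _) (sc0 _ _ _) NC)%N
    => //.
  by rewrite /rado_bound /= !adds0mx_id; lia.
(* With nothing selected the scaling exponent is 2, since t^2 takes t^-1 E into tE; the cost 2n and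
   the value at most -n of tE add up to at most n. *)
have tlat : is_lattice (scale_set (tvar K) (stdE K n)).
  by apply: lattice_scale_stdE; exact: lmonom_neq0.
exists (scale_set (tvar K) (stdE K n)); split; [by left|by []|].
have := detval_via_le e Llat Mlat Nlat tlat (sc2 _ LE) (sc2 _ ME) (sc2 _ NE).
have : detval [:: (n, scale_set (tvar K) (stdE K n))] <= - n%:Z.
  apply: detval_le => [c|Z Zs]; first by rewrite nth_column_sets1.
  have -> : - - n%:Z = \sum_(c < n) 1 by rewrite opprK sumr_const card_ord natz.
  apply: val_ge_det_col => r c; have := Zs c; rewrite nth_column_sets1.
  move=> -[w w0 /colP /(_ r)]; rewrite !mxE => <-.
  rewrite -[1]addr0; apply: val_geM; [exact: val_ge_monom | exact: w0].
by rewrite /rado_bound /=; lia.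
Qed.

Theorem theorem13 (R : realType) (n : nat) (n_gt0 : (1 <= n)%N)
    (L M N : set 'cV[laurent R[i]]_n)
    (L_lattice : is_lattice L) (M_lattice : is_lattice M)
    (N_lattice : is_lattice N)
    (L_ge : stdE R[i] n `<=` L)
    (L_le : L `<=` scale_set (tvar R[i])^-1 (stdE R[i] n))
    (M_ge : stdE R[i] n `<=` M)
    (M_le : M `<=` scale_set (tvar R[i])^-1 (stdE R[i] n))
    (N_ge : stdE R[i] n `<=` N)
    (N_le : N `<=` scale_set (tvar R[i])^-1 (stdE R[i] n))
    (i j k : nat) (ijk : (i + j + k)%N = n) :
  let f := detval [:: (i, L); (j, M); (k, N)] in
  let g1 := fun P : set 'cV[laurent R[i]]_n =>
    detval [:: (i, L); ((j + k)%N, P)] + detval [:: (j, M); ((i + k)%N, P)]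
    + detval [:: (k, N); ((i + j)%N, P)] - 2 * detval [:: (n, P)] in
  let g2 := fun P : set 'cV[laurent R[i]]_n =>
    detval [:: (i, L); (j, P); (k, P)] + detval [:: (i, P); (j, M); (k, P)]
    + detval [:: (i, P); (j, P); (k, N)]
    - 2 * detval [:: (i, P); (j, P); (k, P)] in
  [/\ is_min [set g1 P | P in [set P | is_lattice P]] f,
      is_min [set g2 P | P in [set P | is_lattice P]] f
    & exists P : set 'cV[laurent R[i]]_n,
        [/\ P = scale_set (tvar R[i]) (stdE R[i] n) \/
            [\/ P = L, P = M | P = N] \/
            [\/ P = sum_set L M, P = sum_set L N, P = sum_set M N
              | P = sum_set (sum_set L M) N],
            is_lattice P, g1 P = f & g2 P = f]].
Proof.
move=> f g1 g2.
have g12 P : g2 P = g1 P.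
  by rewrite /g2 /g1; have [-> -> -> ->] := detval_regroup L M N P ijk.
have f_le P : is_lattice P -> f <= g1 P.
  by move=> Plat; apply: detval_le_via.
have [A [LA AL]] := residue_space_ex L_lattice L_ge L_le.
have [B [MB BM]] := residue_space_ex M_lattice M_ge M_le.
have [C [NC CN]] := residue_space_ex N_lattice N_ge N_le.
(* The selection attaining the minimum in Rado's theorem determines which of the eight lattices is
   used. *)
have [b _ bmin] := @arg_minnP _ (true, true, true) xpredT
  (rado_bound i j k A B C) isT.
have [P [Pin Plat Ple]] := eight_lattices b ijk L_lattice M_lattice N_lattice
  L_ge M_ge N_ge L_le M_le N_le LA MB NC.
have Pf : g1 P = f.
  apply/eqP; rewrite eq_le f_le // andbT; apply: le_trans Ple _.
  (* By minimality the bound at [b] is below all eight, so it is a valid lower bound for [f]. *)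
  by apply: detval_ge_rado AL BM CN _ => // b'; exact: bmin.
split.
- by split; [exists P|move=> _ [Q Qlat <-]; exact: f_le].
- split; first by exists P; rewrite ?g12.
  by move=> _ [Q Qlat <-]; rewrite g12; exact: f_le.
by exists P; split; rewrite ?g12.
Qed.
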